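(* Let $\Omega\subset\mathbb{R}^2$ be a normalized convex domain with $0\in\Omega$ the center of $\Omega$. Let $C>0$ and let $f$ be a strictly convex $C^\infty$ function defined on $\Omega$ with $$\inf_\Omega f=0,\qquad f=C \ \text{ on } \partial\Omega .$$ Set $\rho:=[\det(f_{ij})]^{-1/4}$, let $G=\sum_{i,j} f_{ij}\,dx_i\,dx_j$ be the Calabi metric of $f$, and let $\Phi:=\frac{\|\mathrm{grad}\,\rho\|^2}{\rho^2}$, where the gradient and norm are taken with respect to $G$. Assume that $f$ satisfies $$\Delta\rho=0 \quad\text{on }\Omega,$$ where $\Delta$ is the Laplacian of $G$, and that there is a constant $b>0$ such that $$\frac1\rho\le b\quad\text{in }\Omega .$$ Then there exists a real constant $\alpha>0$ such that the following estimates hold on $\Omega_{C/2}:=\{x\in\Omega \mid f(x)<\frac C2\}$: $$\frac{\Phi}{\rho^\alpha}\le d_4,\qquad \frac{\|\mathrm{grad}\, f\|^2}{\rho^\alpha}\le d_4$$ for some real constant $d_4>0$ that depends only on $\alpha$, $b$ and $C$, where $\|\mathrm{grad}\,f\|$ is also taken with respect to $G$.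
   Context: Notation: $f_{ij}=\frac{\partial^2 f}{\partial x_i\partial x_j}$; a strictly convex $C^\infty$ function is one whose Hessian $(f_{ij})$ is positive definite at every point, so that $G=\sum f_{ij}dx_idx_j$ is a Riemannian metric (the Calabi metric). With $(f^{ij})$ the inverse matrix of $(f_{ij})$, one has $\|\mathrm{grad}\,h\|^2=\sum_{i,j} f^{ij}\frac{\partial h}{\partial x_i}\frac{\partial h}{\partial x_j}$ for a smooth function $h$; $\Delta$ denotes the Laplace-Beltrami operator of $G$. A convex domain $\Omega\subset\mathbb{R}^2$ is normalized if its center of mass is the origin $0$ (this is what is meant by the center of $\Omega$) and $B_{2^{-3/2}}(0)\subset\Omega\subset B_1(0)$, where $B_r(0)$ is the Euclidean disc of radius $r$ about $0$. The condition $f=C$ on $\partial\Omega$ is understood for the continuous extension of $f$ to $\overline\Omega$. ''Depends only on $\alpha,b,C$'' means that $d_4$ is given by a function of $\alpha,b,C$ and does not otherwise depend on $\Omega$ or $f$. *)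

(* Defs.v *)
From HB Require Import structures.
From mathcomp Require Import all_boot all_order all_algebra.
From mathcomp Require Import all_classical all_reals all_analysis.

Set Implicit Arguments.
Unset Strict Implicit.
Unset Printing Implicit Defensive.

Import Order.TTheory GRing.Theory Num.Theory.
Import numFieldNormedType.Exports.

Local Open Scope classical_set_scope.
Local Open Scope ring_scope.

(* Points of the plane are row vectors 'rV[R]_2.  The library puts the sup norm
   on them: its topology and its derivatives are the usual ones, but its balls
   are squares, hence the explicit Euclidean disc. *)

Definition disc (R : realType) (r : R) : set 'rV[R]_2 :=
  [set x | \sum_(i < 2) x 0 i ^+ 2 < r ^+ 2].

Definition frontier (T : topologicalType) (A : set T) : set T :=
  closure A `\` interior A.

Definition plane_point (R : realType) (p : R * R) : 'rV[R]_2 :=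
  \row_i (if i == 0 then p.1 else p.2).

(* The library has no measure on 'rV[R]_2: planar integrals are taken with
   respect to the product measure on R * R, through plane_point. *)
Definition planar_integral (R : realType) (A : set 'rV[R]_2)
    (h : 'rV[R]_2 -> R) : R :=
  (\int[(@lebesgue_measure R \x @lebesgue_measure R)%E]_(p in
      @plane_point R @^-1` A) h (plane_point p))%R.

Definition center_of_mass (R : realType) (A : set 'rV[R]_2) : 'rV[R]_2 :=
  \row_i (planar_integral A (fun x => x 0 i) / planar_integral A (fun=> 1)).

Definition normalized_convex_domain (R : realType) (Omega : set 'rV[R]_2) :=
  [/\ open Omega, convex_set Omega, center_of_mass Omega = 0,
      disc (2 `^ (- (3 / 2))) `<=` Omega & Omega `<=` disc 1].

Section Calculus.
Context {R : realType}.
Implicit Types (f h : 'rV[R]_2 -> R) (g : 'rV[R]_2 -> 'M[R]_2).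

Definition partial (i : 'I_2) h : 'rV[R]_2 -> R := 'D_(delta_mx 0 i) h.

(* Functions are total, but every notion below evaluated at a point of an open
   set Omega depends only on the restriction of the functions to Omega. *)

Definition smooth_on (Omega : set 'rV[R]_2) h :=
  forall (s : seq 'I_2) x, Omega x ->
    {for x, continuous (foldr partial h s)} /\
    forall i, derivable (foldr partial h s) x (delta_mx 0 i).

Definition hessian f : 'rV[R]_2 -> 'M[R]_2 :=
  fun x => \matrix_(i, j) partial j (partial i f) x.

Definition positive_definite (A : 'M[R]_2) :=
  forall v : 'rV[R]_2, v != 0 -> 0 < (v *m A *m v^T) 0 0.

Definition strictly_convex_smooth_on (Omega : set 'rV[R]_2) f :=
  smooth_on Omega f /\ forall x, Omega x -> positive_definite (hessian f x).

(* f = C on the boundary, for the continuous extension of f to the closure. *)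
Definition boundary_value (Omega : set 'rV[R]_2) f (C : R) :=
  exists F : 'rV[R]_2 -> R,
    [/\ {within closure Omega, continuous F},
        forall x, Omega x -> F x = f x &
        forall x, frontier Omega x -> F x = C].

Definition grad_normsq g h : 'rV[R]_2 -> R := fun x =>
  \sum_i \sum_j invmx (g x) i j * partial i h x * partial j h x.

Definition laplace_beltrami g h : 'rV[R]_2 -> R := fun x =>
  (Num.sqrt (\det (g x)))^-1 *
  \sum_i partial i (fun y => Num.sqrt (\det (g y)) *
                             \sum_j invmx (g y) i j * partial j h y) x.

(* The Calabi metric of f has matrix hessian f. *)

Definition rho f : 'rV[R]_2 -> R := fun x => (\det (hessian f x)) `^ (- (1 / 4)).

Definition Phi f : 'rV[R]_2 -> R := fun x =>
  grad_normsq (hessian f) (rho f) x / rho f x ^+ 2.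

End Calculus.

(* Main.v *)
Require Import Defs.
From HB Require Import structures.
From mathcomp Require Import all_boot all_order all_algebra.
From mathcomp Require Import all_classical all_reals all_analysis.
From mathcomp Require Import ring lra.
Import Order.TTheory GRing.Theory Num.Theory.
Import numFieldNormedType.Exports.
Local Open Scope classical_set_scope.
Local Open Scope ring_scope.
Set Implicit Arguments.
Unset Strict Implicit.
Unset Printing Implicit Defensive.

(** Write w = c - f with c = 3C/4, u = log rho, E = ||grad f||^2 and
    Phi = ||grad u||^2.  The estimate is a maximum principle for the test
    function
      S = w^14 rho^(-12) (E + w^2 Phi / 32)
    on the sublevel set {f <= c}, which is compact in Omega because f tends to
    C > c at the boundary; the factor w^14 makes S vanish where f = c, so that
    S has an interior maximum unless it vanishes identically.

    At that maximum grad S = 0 and Delta S <= 0.  In dimension two, with B the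
    trace-free part of the cubic form -f_ijk/2, the Gauss curvature of the
    Calabi metric is (|B|^2 - Phi)/2, and Delta rho = 0 amounts to
    Delta u = - Phi.  Bochner's formula then gives the identity
    Delta (log Phi) = |B|^2 + Phi, whose two terms are favourable.  The formula
    for Delta E contains the uncontrolled term 4 u_ij f_i f_j; it is absorbed by
    the full square |Hess u|^2 that Delta Phi provides, which is why the two
    quantities are bounded together and not one after the other.  The factor
    w^2 in front of Phi makes all terms homogeneous: after multiplication by a
    power of w, Delta S becomes a quadratic form in w, E and in the products of
    w, sqrt E with the components of grad u, B and Hess u, up to a nonnegative
    remainder.  The part of that form that does not involve w is positive
    definite for the exponents 12 and 14 and the weight 1/32, so that
    Delta S <= 0 forces E + w^2 Phi / 32 <= 100 w (lemmas test_jet_identity,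
    reduced_form_bound and critical_jet_bound).  Hence S <= 100 b^12 c^15 on the
    sublevel set, since 1/rho <= b, and on {f < C/2}, where w >= C/4, both
    claims follow with alpha = 12.

    To make this a computation with derivatives of f only, put
    D = det (f_ij), so that rho = D^(-1/4), and
    Q(h) = f_22 h_1^2 - 2 f_12 h_1 h_2 + f_11 h_2^2.  Then E = Q(f)/D,
    Phi = Q(D)/(16 D^3), the test function is the polynomial
    w^14 (D^2 Q(f) + w^2 Q(D)/512), and Delta rho = 0 reads
    4 D (f_22 D_11 - 2 f_12 D_12 + f_11 D_22) = 7 Q(D).  Replacing the two
    coordinate directions by any other basis of constant vectors multiplies
    these expressions by powers of the determinant of the basis, so at the
    maximum one may use a basis in which the Hessian is the identity and whose
    second vector is tangent to the level line of f. *)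

(** * Restriction of functions to lines *)

Section Lines.
Context {R : realType} {V : normedModType R}.
Implicit Types (h : V -> R) (x v : V).

Lemma is_derive_line h x v (t : R) : derivable h (x + t *: v) v ->
  is_derive t 1 (fun s : R => h (x + s *: v)) ('D_v h (x + t *: v)).
Proof.
pose g (s : R) := h (x + s *: v).
have E : (fun s : R => s^-1 *: ((g \o shift t) (s *: 1) - g t)) =
         (fun s : R => s^-1 *: ((h \o shift (x + t *: v)) (s *: v)
                                - h (x + t *: v))).
  apply/funext => s; rewrite /g /=; congr (_ *: (h _ - _)).
  by rewrite [s *: 1]mulr1 scalerDl addrCA.
by move=> dh; apply: DeriveDef; rewrite /derivable /derive -/g E.
Qed.

(** The line through [x] in direction [t *: v] is the line in direction [v] run
    at speed [t], so this is the chain rule for [s |-> t * s]. *)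
Lemma is_derive_scale h x v (t : R) : derivable h x v ->
  is_derive x (t *: v) h (t * 'D_v h x).
Proof.
move=> dh; have dl : derivable h (x + (t * 0) *: v) v.
  by rewrite mulr0 scale0r addr0.
have := is_derive_line dl.
rewrite mulr0 scale0r addr0 => d0.
have dm : is_derive (0 : R) 1 (fun s : R => t * s) t.
  by apply: is_derive_eq; rewrite [_%:A]mulr1.
have d0' : is_derive (t * 0) 1 (fun s : R => h (x + s *: v)) ('D_v h x).
  by rewrite mulr0.
have dc := is_derive1_comp d0' dm.
have E : (fun s : R => s^-1 *: ((h \o shift x) (s *: (t *: v)) - h x)) =
  (fun s : R => s^-1 *: ((((fun s : R => h (x + s *: v)) \o (fun s => t * s))
      \o shift 0) (s *: 1)
      - ((fun s : R => h (x + s *: v)) \o (fun s => t * s)) 0)).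
  apply/funext => s /=; rewrite mulr0 scale0r !addr0; congr (_ *: (h _ - _)).
  by rewrite [s *: 1]mulr1 scalerA addrC mulrC.
case: dc => dc1 dc2; apply: DeriveDef; first by rewrite /derivable E.
by rewrite /derive E [LHS]dc2 mulrC.
Qed.

(** The mean value theorem on the segment from [x] to [x + v]. *)
Lemma mvt_line h x v :
  (forall s : R, 0 <= s <= 1 -> derivable h (x + s *: v) v) ->
  exists2 c : R, 0 < c < 1 & h (x + v) - h x = 'D_v h (x + c *: v).
Proof.
move=> dh; have [| |c /[!in_itv]/= /andP[c0 c1] E] :=
    @MVT R (fun s => h (x + s *: v)) (fun s => 'D_v h (x + s *: v)) 0 1 ltr01.
- move=> s /[!in_itv]/= /andP[s0 s1]; apply: is_derive_line; apply: dh.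
  by rewrite !ltW.
- apply: derivable_within_continuous => s /[!in_itv]/= s01.
  by have [] := is_derive_line (dh _ s01).
exists c; first by rewrite c0.
by move: E; rewrite scale1r scale0r addr0 subr0 mulr1.
Qed.

End Lines.

(** * Functions with continuous partial derivatives *)

Lemma sum_I2 (M : nmodType) (F : 'I_2 -> M) : \sum_i F i = F 0 + F 1.
Proof.
by rewrite big_ord_recl big_ord1; congr (F _ + F _); apply/val_inj.
Qed.

Lemma ordI2_cases (i : 'I_2) : i = 0 \/ i = 1.
Proof. by case: i => [[|[|//]] ?]; [left|right]; apply/val_inj. Qed.

Section LinearForm.
Context {R : realType} (a : 'I_2 -> R).

Definition linear_form (v : 'rV[R]_2) : R := \sum_i v 0 i * a i.

Lemma linear_form_is_linear : linear linear_form.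
Proof.
move=> k u v; rewrite /linear_form !sum_I2 !mxE.
rewrite -[X in _ = X + _]/(k * _); ring.
Qed.

HB.instance Definition _ :=
  GRing.isLinear.Build R 'rV[R]_2 R _ linear_form linear_form_is_linear.

Lemma continuous_linear_form : continuous linear_form.
Proof.
have -> : (linear_form : _ -> _) = (fun v => v 0 0 * a 0 + v 0 1 * a 1).
  by apply/funext => v; rewrite /linear_form sum_I2.
move=> v.
have H i : {for v, continuous (fun v : 'rV[R]_2 => v 0 i * a i)}.
  apply: (@continuousM _ _ (fun v : 'rV[R]_2 => v 0 i) (cst (a i))).
    exact: coord_continuous.
  exact: cst_continuous.
exact: (continuousD (H 0) (H 1)).
Qed.

End LinearForm.

Lemma differentiable_epsP (R : realType) (V W : normedModType R) (h : V -> W)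
    (L : {linear V -> W}) (x : V) : continuous L ->
  (forall e : R, 0 < e ->
     \forall v \near 0, `|h (v + x) - (h x + L v)| <= e * `|v|) ->
  differentiable h x /\ 'd h x = L :> (V -> W).
Proof.
move=> cL H; have E : h \o shift x = cst (h x) + L +o_ 0 id.
  by apply/eqaddoP => e /H; apply: filterS => v.
have dE := diff_unique cL E; split => //.
by apply/diff_locallyP; rewrite dE; split.
Qed.

Section Plane.
Context {R : realType}.
Implicit Types (h : 'rV[R]_2 -> R) (x v : 'rV[R]_2).

Lemma coord_norm_le v i : `|v 0 i| <= `|v|.
Proof.
rewrite [leRHS]/Num.norm /= mx_normrE; apply/bigmax_geP; right => /=.
by exists (0, i).
Qed.

Lemma norm_le_coord v (c : R) : `|v 0 0| <= c -> `|v 0 1| <= c -> `|v| <= c.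
Proof.
move=> v0 v1; rewrite [leLHS]/Num.norm /= mx_normrE; apply/bigmax_leP.
split=> [|[j i] _ /=]; first exact: le_trans v0.
by rewrite ord1; have [->|->] := ordI2_cases i.
Qed.

Lemma row2E v : v = v 0 0 *: delta_mx 0 0 + v 0 1 *: delta_mx 0 1.
Proof.
by rewrite [LHS]row_sum_delta sum_I2.
Qed.

(** The increment of [h] along [v] is split into a horizontal and a vertical
    step; the mean value theorem on each step and the continuity of the partial
    derivatives show that the remainder is small compared with [v]. *)
Lemma c1_differentiable h x :
  (\forall y \near x, forall i, derivable h y (delta_mx 0 i)) ->
  (forall i, {for x, continuous (partial i h)}) ->
  differentiable h x /\ forall v, 'D_v h x = \sum_i v 0 i * partial i h x.
Proof.
move=> dh ch; pose L := linear_form (fun i => partial i h x).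
suff [dh' E] : differentiable h x /\ 'd h x = L :> (_ -> _).
  by split => // v; rewrite deriveE // E.
apply: differentiable_epsP => [|e e0]; first exact: continuous_linear_form.
  have e20 : 0 < e / 2 by rewrite divr_gt0.
  have c0 : \forall y \near x, `|partial 0 h x - partial 0 h y| < e / 2.
    by have /cvgrPdist_lt/(_ _ e20) := ch 0.
  have c1 : \forall y \near x, `|partial 1 h x - partial 1 h y| < e / 2.
    by have /cvgrPdist_lt/(_ _ e20) := ch 1.
  have [r /= r0 H] := (nbhs_ballP _ _).1 (filterI dh (filterI c0 c1)).
  have {}H w : `|w| < r -> [/\ forall i, derivable h (x + w) (delta_mx 0 i),
      `|partial 0 h x - partial 0 h (x + w)| < e / 2 &
      `|partial 1 h x - partial 1 h (x + w)| < e / 2].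
    move=> wr; have [//|? []//] := H (x + w).
    by rewrite -ball_normE /= opprD addNKr normrN.
  have : \forall v \near (0 : 'rV[R]_2), `|v| < r.
    by apply/nbhs_ballP; exists r => //= v; rewrite -ball_normE /= sub0r normrN.
  apply: filterS => v vr.
  have n0 (s : R) : 0 <= s <= 1 ->
      `|s *: (v 0 0 *: delta_mx 0 0 : 'rV[R]_2)| <= `|v|.
    move=> /andP[s0 s1]; apply: norm_le_coord => //; rewrite !mxE /=.
      rewrite mulr1 normrM (le_trans _ (coord_norm_le v 0))//.
      by rewrite ler_piMl// ger0_norm.
    by rewrite !mulr0 normr0.
  have n1 (s : R) : 0 <= s <= 1 ->
      `|v 0 0 *: delta_mx 0 0 + s *: (v 0 1 *: delta_mx 0 1 : 'rV[R]_2)|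
        <= `|v|.
    move=> /andP[s0 s1]; apply: norm_le_coord => //; rewrite !mxE /=.
      by rewrite mulr1 !mulr0 addr0 coord_norm_le.
    rewrite mulr0 mulr1 add0r normrM (le_trans _ (coord_norm_le v 1))//.
    by rewrite ler_piMl// ger0_norm.
  have [s s01 E0] : exists2 s : R, 0 <= s <= 1 & 
     h (x + v 0 0 *: delta_mx 0 0) - h x =
      v 0 0 * partial 0 h (x + s *: (v 0 0 *: delta_mx 0 0)).
    have [s s01|s /andP[s0 s1] ->] := @mvt_line _ _ h x (v 0 0 *: delta_mx 0 0).
      have [d _ _] := H _ (le_lt_trans (n0 s s01) vr).
      by have [] := is_derive_scale (v 0 0) (d 0).
    have s01 : 0 <= s <= 1 by rewrite !ltW.
    exists s => //; have [d _ _] := H _ (le_lt_trans (n0 s s01) vr).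
    by have [_ ->] := is_derive_scale (v 0 0) (d 0).
  have [t t01 E1] : exists2 t : R, 0 <= t <= 1 & 
     h (x + v) - h (x + v 0 0 *: delta_mx 0 0) =
      v 0 1 * partial 1 h
        (x + (v 0 0 *: delta_mx 0 0 + t *: (v 0 1 *: delta_mx 0 1))).
    have [t t01|t /andP[t0 t1]] := 
        @mvt_line _ _ h (x + v 0 0 *: delta_mx 0 0) (v 0 1 *: delta_mx 0 1).
      have [d _ _] := H _ (le_lt_trans (n1 t t01) vr).
      rewrite -addrA.
      by have [] := is_derive_scale (v 0 1) (d 1).
    rewrite -!addrA -row2E => ->.
    have t01 : 0 <= t <= 1 by rewrite !ltW.
    exists t; first exact: t01.
    have [d _ _] := H _ (le_lt_trans (n1 t t01) vr).
    exact: (derive_val (is_derive := is_derive_scale (v 0 1) (d 1))).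
  have [_ B0 _] := H _ (le_lt_trans (n0 s s01) vr).
  have [_ _ B1] := H _ (le_lt_trans (n1 t t01) vr).
  rewrite /= /L /linear_form sum_I2 [v + x]addrC.
  set p0 := partial 0 h x in B0 *; set p1 := partial 1 h x in B1 *.
  set q0 := partial 0 h _ in B0 E0; set q1 := partial 1 h _ in B1 E1.
  have -> : h (x + v) - (h x + (v 0 0 * p0 + v 0 1 * p1)) =
     - (v 0 0 * (p0 - q0) + v 0 1 * (p1 - q1)).
    rewrite -(subrK (h (x + v 0 0 *: delta_mx 0 0)) (h (x + v))) E1.
    by rewrite -(subrK (h x) (h (x + v 0 0 *: delta_mx 0 0))) E0; ring.
  rewrite normrN (le_trans (ler_normD _ _)) // !normrM [e]splitr mulrDl.
  have C (b : R) i : `|b| < e / 2 -> `|v 0 i| * `|b| <= e / 2 * `|v|.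
    by move=> /ltW be; rewrite mulrC; apply: ler_pM => //; exact: coord_norm_le.
  by rewrite lerD // C.
Qed.

End Plane.

(** * The algebra of smooth functions *)

Section Smooth.
Context {R : realType}.
Implicit Types (f g h : 'rV[R]_2 -> R) (x y v w : 'rV[R]_2).
Variable Omega : set 'rV[R]_2.
Hypothesis openO : open Omega.
Local Notation smooth := (smooth_on Omega).

Lemma near_open x : Omega x -> \forall y \near x, Omega y.
Proof. by move=> Ox; apply: open_nbhs_nbhs; split. Qed.

Lemma near_eq_on g h x : (forall y, Omega y -> g y = h y) -> Omega x ->
  {near x, g =1 h}.
Proof. by move=> gh /near_open; apply: filterS. Qed.

Lemma eq_on_derive v g h x : (forall y, Omega y -> g y = h y) -> Omega x ->
  'D_v g x = 'D_v h x.
Proof. by move=> gh Ox; apply: near_eq_derive; exact: near_eq_on gh Ox. Qed.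

Lemma eq_on_foldr_partial s g h : (forall y, Omega y -> g y = h y) ->
  forall x, Omega x -> foldr partial g s x = foldr partial h s x.
Proof.
move=> gh; elim: s => //= i s IH x Ox; exact: eq_on_derive.
Qed.

Definition regular n h := forall s x, (size s <= n)%N -> Omega x ->
  {for x, continuous (foldr partial h s)} /\
  forall i, derivable (foldr partial h s) x (delta_mx 0 i).

Lemma smooth_regularP h : smooth h <-> forall n, regular n h.
Proof.
split=> [sh n s x _|H s x]; [exact: sh|exact: (H _ s x (leqnn _))].
Qed.

Lemma regular_leq m n h : (m <= n)%N -> regular n h -> regular m h.
Proof. by move=> mn H s x sm; apply: H; exact: leq_trans mn. Qed.

(** The last letter of a word of partial derivatives is the one applied first;
    splitting it off makes induction on the order possible. *)
Lemma regularS n h :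
  regular n.+1 h <-> regular 0 h /\ forall i, regular n (partial i h).
Proof.
split=> [H|[H0 H] s x].
  split=> [|i s x sn]; first exact: regular_leq H.
  by have := H (rcons s i) x; rewrite foldr_rcons size_rcons; apply.
case/lastP: s => [|s i]; first by move=> _; exact: H0.
by rewrite foldr_rcons size_rcons => sn; exact: H.
Qed.

Lemma eq_on_regular n g h : (forall y, Omega y -> g y = h y) ->
  regular n g -> regular n h.
Proof.
move=> gh sg s x sn Ox; have [cg dg] := sg s x sn Ox.
have E := near_eq_on (eq_on_foldr_partial s gh) Ox.
split=> [|i]; last exact: near_eq_derivable E (dg i).
rewrite /prop_for /continuous_at -(eq_on_foldr_partial s gh Ox).
exact: cvg_trans (near_eq_cvg E) cg.
Qed.

Lemma eq_on_smooth g h : (forall y, Omega y -> g y = h y) ->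
  smooth g -> smooth h.
Proof.
move=> gh /smooth_regularP H; apply/smooth_regularP => n.
exact: eq_on_regular (H n).
Qed.
#[global] Arguments eq_on_smooth {g h} _ _.

Lemma regular_add n g h : regular n g -> regular n h ->
  regular n (fun y => g y + h y).
Proof.
have R0 g' h' : regular 0 g' -> regular 0 h' -> regular 0 (fun y => g' y + h' y).
  move=> rg rh [|//] x _ Ox; have [cg dg] := rg [::] x isT Ox.
  have [ch dh] := rh [::] x isT Ox.
  by split=> [|i]; [exact: continuousD|exact: derivableD].
elim: n g h => [|n IH] g h; first exact: R0.
move=> /regularS[g0 gS] /regularS[h0 hS]; apply/regularS; split=> [|i].
  exact: R0.
apply: eq_on_regular (IH _ _ (gS i) (hS i)) => y Oy.
have [_ dg] := g0 [::] y isT Oy; have [_ dh] := h0 [::] y isT Oy.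
by rewrite /partial [RHS]deriveD.
Qed.

(** Regularity up to a fixed order, rather than smoothness itself, is the
    inductive statement, because the derivative of a product is a sum of
    products about which only finitely many derivatives are known. *)
Lemma regular_mul n g h : regular n g -> regular n h ->
  regular n (fun y => g y * h y).
Proof.
have R0 g' h' : regular 0 g' -> regular 0 h' -> regular 0 (fun y => g' y * h' y).
  move=> rg rh [|//] x _ Ox; have [cg dg] := rg [::] x isT Ox.
  have [ch dh] := rh [::] x isT Ox.
  by split=> [|i]; [exact: continuousM|exact: derivableM].
elim: n g h => [|n IH] g h; first exact: R0.
move=> rg rh; have rg' := regular_leq (leqnSn n) rg.
have rh' := regular_leq (leqnSn n) rh.
move/regularS: rg => [g0 gS]; move/regularS: rh => [h0 hS].
apply/regularS; split=> [|i]; first exact: R0.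
apply: eq_on_regular (regular_add (IH _ _ rg' (hS i)) (IH _ _ rh' (gS i))) => y Oy.
have [_ dg] := g0 [::] y isT Oy; have [_ dh] := h0 [::] y isT Oy.
by rewrite /partial [RHS]deriveM.
Qed.

Lemma smooth_partial i h : smooth h -> smooth (partial i h).
Proof. by move=> sh s x Ox; have := sh (rcons s i) x Ox; rewrite foldr_rcons. Qed.
#[global] Arguments smooth_partial i {h} _.

Lemma smooth_continuous h x : smooth h -> Omega x -> {for x, continuous h}.
Proof. by move=> sh Ox; have [] := sh [::] x Ox. Qed.
#[global] Arguments smooth_continuous {h x} _ _.

Lemma smooth_differentiable h x : smooth h -> Omega x -> differentiable h x.
Proof.
move=> sh Ox; apply: (proj1 (c1_differentiable _ _)).
  by move/near_open: Ox; apply: filterS => y Oy i; have [] := sh [::] y Oy.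
by move=> i; exact: smooth_continuous (smooth_partial i sh) Ox.
Qed.
#[global] Arguments smooth_differentiable {h x} _ _.

Lemma smooth_derivable h x v : smooth h -> Omega x -> derivable h x v.
Proof. by move=> sh Ox; apply/diff_derivable/smooth_differentiable. Qed.
#[global] Arguments smooth_derivable {h x} v _ _.

Lemma smooth_derive_partial h v x : smooth h -> Omega x ->
  'D_v h x = v 0 0 * partial 0 h x + v 0 1 * partial 1 h x.
Proof.
move=> sh Ox; rewrite -(sum_I2 (fun i => v 0 i * partial i h x)).
apply: (proj2 (c1_differentiable _ _)).
  by move/near_open: Ox; apply: filterS => y Oy i; have [] := sh [::] y Oy.
by move=> i; exact: smooth_continuous (smooth_partial i sh) Ox.
Qed.

Lemma smooth_cst (c : R) : smooth (fun=> c).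
Proof.
move=> s; have [k ->] : exists k : R, foldr partial (fun=> c) s = cst k.
  elim: s => [|i s [k IH]]; [by exists c|exists 0]; rewrite /= IH.
  by apply/funext => x; rewrite /partial derive_cst.
by move=> x _; split=> [|i]; [exact: cst_continuous|exact: derivable_cst].
Qed.

Lemma derive_add v g h x : smooth g -> smooth h -> Omega x ->
  'D_v (fun y => g y + h y) x = 'D_v g x + 'D_v h x.
Proof. by move=> sg sh Ox; apply: deriveD; exact: smooth_derivable. Qed.

Lemma derive_mul v g h x : smooth g -> smooth h -> Omega x ->
  'D_v (fun y => g y * h y) x = 'D_v g x * h x + g x * 'D_v h x.
Proof.
move=> sg sh Ox; rewrite [LHS](@deriveM _ _ g h x v); try exact: smooth_derivable.
by rewrite addrC; congr (_ + _); rewrite [LHS]mulrC.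
Qed.

Lemma smooth_add g h : smooth g -> smooth h -> smooth (fun y => g y + h y).
Proof.
move=> /smooth_regularP rg /smooth_regularP rh; apply/smooth_regularP => n.
exact: regular_add.
Qed.
#[global] Arguments smooth_add {g h} _ _.

Lemma smooth_mul g h : smooth g -> smooth h -> smooth (fun y => g y * h y).
Proof.
move=> /smooth_regularP rg /smooth_regularP rh; apply/smooth_regularP => n.
exact: regular_mul.
Qed.
#[global] Arguments smooth_mul {g h} _ _.

Lemma smooth_derive h v : smooth h -> smooth ('D_v h).
Proof.
move=> sh; pose g y := v 0 0 * partial 0 h y + v 0 1 * partial 1 h y.
apply: (@eq_on_smooth g) => [y Oy|]; first by rewrite [RHS]smooth_derive_partial.
by apply: smooth_add; (apply: smooth_mul; [exact: smooth_cst|exact: smooth_partial]).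
Qed.
#[global] Arguments smooth_derive {h} v _.

End Smooth.

(** * Symmetry of second derivatives and local maxima *)

Section Schwarz.
Context {R : realType}.
Implicit Types (h : 'rV[R]_2 -> R) (x y v w : 'rV[R]_2).
Variable Omega : set 'rV[R]_2.
Hypothesis openO : open Omega.
Local Notation smooth := (smooth_on Omega).

Lemma is_derive_shift_arg h v w x : derivable h (x + w) v ->
  is_derive x v (fun y => h (y + w)) ('D_v h (x + w)).
Proof.
have E : (fun s : R =>
      s^-1 *: (((fun y => h (y + w)) \o shift x) (s *: v) - h (x + w)))
  = (fun s : R => s^-1 *: ((h \o shift (x + w)) (s *: v) - h (x + w))).
  by apply/funext => s /=; rewrite addrA.
by move=> d; apply: DeriveDef; rewrite /derivable /derive E.
Qed.

Lemma derive_scale h x v (t : R) : smooth h -> Omega x ->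
  'D_(t *: v) h x = t * 'D_v h x.
Proof.
move=> sh Ox; have d := smooth_derivable openO v sh Ox.
by have [_ ->] := is_derive_scale t d.
Qed.

#[global] Arguments derive_scale {h x} v t _ _.

Lemma derive_cmul v (c : R) h x : smooth h -> Omega x ->
  'D_v (fun y => c * h y) x = c * 'D_v h x.
Proof.
move=> sh Ox; rewrite (derive_mul openO v (smooth_cst c) sh Ox).
by rewrite derive_cst mul0r add0r.
Qed.

Lemma derive_scale2 h x v w (t : R) : smooth h -> Omega x ->
  'D_(t *: w) ('D_(t *: v) h) x = t ^+ 2 * 'D_w ('D_v h) x.
Proof.
move=> sh Ox.
have sD (u : 'rV[R]_2) : smooth ('D_u h) by exact: (smooth_derive openO u sh).
rewrite (derive_scale w t (sD _) Ox).
have E y : Omega y -> 'D_(t *: v) h y = t * 'D_v h y.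
  by move=> Oy; rewrite (derive_scale v t sh Oy).
by rewrite (eq_on_derive openO w E Ox) (derive_cmul w t (sD v) Ox) mulrA expr2.
Qed.

#[global] Arguments derive_cmul v c {h x} _ _.
#[global] Arguments derive_scale2 {h x} v w t _ _.

(** The increment of [y |-> h (y + w) - h y] along [v] is computed by the mean
    value theorem, and the increment that appears in it by a second one along
    [w]. *)
Lemma double_difference h x v w : smooth h ->
  (forall s t : R, 0 <= s <= 1 -> 0 <= t <= 1 -> Omega (x + s *: v + t *: w)) ->
  exists s t : R, [/\ 0 <= s <= 1, 0 <= t <= 1 &
    h (x + v + w) - h (x + v) - (h (x + w) - h x) =
    'D_w ('D_v h) (x + s *: v + t *: w)].
Proof.
move=> sh O.
have i0 : 0 <= (0 : R) <= 1 by apply/andP; split; rewrite ?lexx ?ler01.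
have i1 : 0 <= (1 : R) <= 1 by apply/andP; split; rewrite ?lexx ?ler01.
have O0 (s : R) : 0 <= s <= 1 -> Omega (x + s *: v).
  by move=> s01; have := O s 0 s01 i0; rewrite scale0r addr0.
have O1 (s : R) : 0 <= s <= 1 -> Omega (x + s *: v + w).
  by move=> s01; have := O s 1 s01 i1; rewrite scale1r.
have dk (s : R) : 0 <= s <= 1 ->
    is_derive (x + s *: v) v (fun y => h (y + w) - h y)
      ('D_v h (x + s *: v + w) - 'D_v h (x + s *: v)).
  move=> s01; apply: is_deriveB.
    exact: (is_derive_shift_arg (smooth_derivable openO v sh (O1 s s01))).
  exact: (derivableP (smooth_derivable openO v sh (O0 s s01))).
have [s s01|s /andP[s0 s1] E1] := @mvt_line _ _ (fun y => h (y + w) - h y) x v.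
  by have [] := dk s s01.
have s01 : 0 <= s <= 1 by rewrite !ltW.
have sD := smooth_derive openO v sh.
have [t t01|t /andP[t0 t1] E2] := @mvt_line _ _ ('D_v h) (x + s *: v) w.
  by exact: (smooth_derivable openO w sD (O s t s01 t01)).
exists s, t; split; rewrite ?ltW//.
by have [_ Ek] := dk s s01; rewrite E1 Ek E2.
Qed.

(** The double difference of [h] is symmetric in [v] and [w], and divided by
    [r ^+ 2] it is a value of each mixed derivative at a point that tends to
    [x] with [r]. *)
Lemma schwarz h x v w : smooth h -> Omega x ->
  'D_w ('D_v h) x = 'D_v ('D_w h) x.
Proof.
move=> sh Ox.
have sA := smooth_derive openO w (smooth_derive openO v sh).
have sB := smooth_derive openO v (smooth_derive openO w sh).
set A := 'D_w ('D_v h) in sA *; set B := 'D_v ('D_w h) in sB *.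
apply/eqP; rewrite -subr_eq0 -normr_le0; apply/ler_addgt0Pl => e e0; rewrite addr0.
have e20 : 0 < e / 2 by rewrite divr_gt0.
have cA : \forall y \near x, `|A x - A y| < e / 2.
  by have /cvgrPdist_lt/(_ _ e20) := smooth_continuous sA Ox.
have cB : \forall y \near x, `|B x - B y| < e / 2.
  by have /cvgrPdist_lt/(_ _ e20) := smooth_continuous sB Ox.
have [d /= d0 H] := (nbhs_ballP _ _).1
  (filterI (near_open openO Ox) (filterI cA cB)).
pose r := d / (`|v| + `|w| + 1).
have N0 : 0 < `|v| + `|w| + 1 by rewrite ltr_wpDl// addr_ge0.
have r0 : 0 < r by rewrite divr_gt0.
have {}H s t : 0 <= s <= 1 -> 0 <= t <= 1 ->
   let y := x + s *: (r *: v) + t *: (r *: w) in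
   [/\ Omega y, `|A x - A y| < e / 2 & `|B x - B y| < e / 2].
  move=> /andP[s0 s1] /andP[t0 t1] /=.
  set y := x + _ + _; have [] := H y; last by move=> ? [].
  rewrite -ball_normE /= /y -addrA opprD addNKr normrN.
  rewrite (le_lt_trans (ler_normD _ _))// !normrZ !ger0_norm// ?ltW//.
  rewrite (@le_lt_trans _ _ (r * (`|v| + `|w|)))//.
    rewrite mulrDr; apply: lerD; rewrite ler_piMl// mulr_ge0// ltW//.
  rewrite /r mulrAC ltr_pdivrMr// ltr_pM2l// ltrDl//.
have [s [t [s01 t01 E1]]] : exists s t : R, [/\ 0 <= s <= 1, 0 <= t <= 1 &
    h (x + r *: v + r *: w) - h (x + r *: v) - (h (x + r *: w) - h x) =
    r ^+ 2 * A (x + s *: (r *: v) + t *: (r *: w))].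
  have [s t s01 t01|s [t [s01 t01 E]]] := 
      @double_difference h x (r *: v) (r *: w) sh.
    by have [] := H s t s01 t01.
  exists s, t; split; [exact: s01|exact: t01|apply: (etrans E)].
  have [Oy _ _] := H s t s01 t01.
  exact: (derive_scale2 v w r sh Oy).
have [s2 [t2 [q2 p2 E2]]] : exists s t : R, [/\ 0 <= s <= 1, 0 <= t <= 1 &
    h (x + r *: w + r *: v) - h (x + r *: w) - (h (x + r *: v) - h x) =
    r ^+ 2 * B (x + t *: (r *: v) + s *: (r *: w))].
  have O' s2 t2 : 0 <= s2 <= 1 -> 0 <= t2 <= 1 ->
      Omega (x + s2 *: (r *: w) + t2 *: (r *: v)).
    by move=> p2 q2; rewrite addrAC; have [] := H t2 s2 q2 p2.
  have [s2 [t2 [p2 q2 E]]] := @double_difference h x (r *: w) (r *: v) sh O'.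
  exists s2, t2; split; [exact: p2|exact: q2|].
  have Oy := O' s2 t2 p2 q2.
  apply: (etrans E); apply: (etrans (derive_scale2 w v r sh Oy)).
  congr (_ * B _); exact: addrAC.
have [_ HA _] := H s t s01 t01; have [_ _ HB] := H t2 s2 p2 q2.
have AB : A (x + s *: (r *: v) + t *: (r *: w)) =
    B (x + t2 *: (r *: v) + s2 *: (r *: w)).
  apply: (@mulfI _ (r ^+ 2)); first by rewrite expf_neq0 ?gt_eqF.
  have AC (a b c d' : R) : a - b - (c - d') = a - c - (b - d') by ring.
  apply: (etrans (esym E1)); apply: etrans E2.
  rewrite [x + r *: w + r *: v]addrAC; exact: AC.
rewrite AB in HA; move: HA HB; set b := B (x + _ + _) => HA HB.
apply: (le_trans (ler_distD b (A x) (B x))).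
rewrite [e]splitr; apply/ltW/ltrD; first exact: HA.
by rewrite distrC; exact: HB.
Qed.

Lemma local_max_ball h x : Omega x -> (\forall y \near x, h y <= h x) ->
  exists2 r : R, 0 < r & forall v, `|v| < r -> Omega (x + v) /\ h (x + v) <= h x.
Proof.
move=> Ox Hmax.
have [r /= r0 H] := (nbhs_ballP _ _).1 (filterI (near_open openO Ox) Hmax).
exists r => // v vr; apply: H.
by rewrite -ball_normE /= opprD addNKr normrN.
Qed.

Lemma local_max_derive h x v : smooth h -> Omega x ->
  (\forall y \near x, h y <= h x) -> 'D_v h x = 0.
Proof.
move=> sh Ox /(local_max_ball Ox)[r r0 H].
pose d := r / (`|v| + 1).
have N0 : 0 < `|v| + 1 by rewrite ltr_wpDl.
have d0 : 0 < d by rewrite divr_gt0.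
have {}H (s : R) : s \in `]-d, d[ -> Omega (x + s *: v) /\ h (x + s *: v) <= h x.
  rewrite in_itv/= -ltr_norml => sd; apply: H; rewrite normrZ.
  apply: (@le_lt_trans _ _ (d * `|v|)); first by rewrite ler_wpM2r// ltW.
  by rewrite /d mulrAC ltr_pdivrMr// ltr_pM2l// ltrDl.
have D (s : R) : s \in `]-d, d[ ->
    is_derive s 1 (fun s : R => h (x + s *: v)) ('D_v h (x + s *: v)).
  by move=> /H[Oy _]; exact: (is_derive_line (smooth_derivable openO v sh Oy)).
have z : (0 : R) \in `]-d, d[ by rewrite in_itv/= oppr_lt0 d0.
have [||//|s sd|_ E] := @derive1_at_max _ (fun s : R => h (x + s *: v)) (-d) d 0.
- by rewrite ge0_cp// ltW.
- by move=> s /D[].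
- by rewrite scale0r addr0; exact: (H s sd).2.
by have [_] := D 0 z; rewrite E scale0r addr0 => <-.
Qed.

(** If the second derivative were positive, the first one would be positive at
    the points [x + s *: v] with [s] small and positive, and [h] would increase
    strictly there. *)
Lemma local_max_derive2 h x v : smooth h -> Omega x ->
  (\forall y \near x, h y <= h x) -> 'D_v ('D_v h) x <= 0.
Proof.
move=> sh Ox Hmax; rewrite leNgt; apply/negP => D2.
have D1 := local_max_derive v sh Ox Hmax.
have sD := smooth_derive openO v sh.
have [r r0 H] := local_max_ball Ox Hmax.
have dD := smooth_derivable openO v sD Ox.
have Dpos : \forall s \near (0 : R)^', 0 < s^-1 * 'D_v h (s *: v + x).
  have /cvgr_gt/(_ 0 D2) := dD.
  by apply: filterS => s; rewrite D1 subr0.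
have [e /= e0 Hpos] := (nbhs_ballP _ _).1 Dpos.
have N0 : 0 < `|v| + 1 by rewrite ltr_wpDl.
pose d := Num.min (e / 2) (r / (`|v| + 1)).
have d0 : 0 < d by rewrite lt_min !divr_gt0.
have de : d < e by rewrite gt_min ltr_pdivrMr// ltr_pMr ?ltr1n.
have dr : `|d *: v| < r.
  rewrite normrZ gtr0_norm//.
  apply: (@le_lt_trans _ _ (r / (`|v| + 1) * `|v|)).
    by rewrite ler_wpM2r// ge_min lexx orbT.
  by rewrite mulrAC ltr_pdivrMr// ltr_pM2l// ltrDl.
have dO (s : R) : 0 <= s <= 1 -> Omega (x + s *: (d *: v)).
  move=> /andP[s0 s1]; apply: (proj1 (H _ _)).
  by rewrite (le_lt_trans _ dr)// normrZ ler_piMl// ger0_norm.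
have [s s01|s /andP[s0 s1] E] := @mvt_line _ _ h x (d *: v).
  exact: (smooth_derivable openO _ sh (dO s s01)).
have s01 : 0 <= s <= 1 by rewrite !ltW.
have Os := dO s s01.
have sd0 : 0 < s * d by rewrite mulr_gt0.
have P : 0 < 'D_v h (x + s *: (d *: v)).
  have : 0 < (s * d)^-1 * 'D_v h ((s * d) *: v + x).
    apply: Hpos; last by rewrite gt_eqF.
    rewrite -ball_normE /= sub0r normrN gtr0_norm//.
    by rewrite (lt_trans _ de)// -[ltRHS]mul1r ltr_pM2r.
  by rewrite pmulr_rgt0 ?invr_gt0// addrC scalerA.
have := (H _ dr).2; rewrite -subr_le0 E (derive_scale v d sh Os).
by rewrite leNgt mulr_gt0.
Qed.

End Schwarz.

(** * The algebraic inequality at a critical point *)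

Section Jets.
Context {R : realType}.

(** Values and first two derivatives along a line.  These triples multiply like
    truncated Taylor expansions, but without division by factorials. *)
Definition jet2 : Type := R * R * R.
Definition jcst (c : R) : jet2 := (c, 0, 0).
Definition jadd (p q : jet2) : jet2 :=
  let: (p0, p1, p2) := p in let: (q0, q1, q2) := q in
  (p0 + q0, p1 + q1, p2 + q2).
Definition jmul (p q : jet2) : jet2 :=
  let: (p0, p1, p2) := p in let: (q0, q1, q2) := q in
  (p0 * q0, p1 * q0 + p0 * q1, p2 * q0 + 2 * (p1 * q1) + p0 * q2).
(** The power of exponent [n.+2]: the shift keeps the exponents of the two
    derivatives natural numbers. *)
Definition jexp (p : jet2) (n : nat) : jet2 :=
  let: (p0, p1, p2) := p in
  (p0 ^+ n.+2, n.+2%:R * p0 ^+ n.+1 * p1,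
   n.+2%:R * n.+1%:R * p0 ^+ n * p1 ^+ 2 + n.+2%:R * p0 ^+ n.+1 * p2).

Definition jquad (q11 q12 q22 h1 h2 : jet2) : jet2 :=
  jadd (jadd (jmul q22 (jmul h1 h1)) (jmul (jcst (- 2)) (jmul q12 (jmul h1 h2))))
       (jmul q11 (jmul h2 h2)).

(** The jet of the test function in terms of those of [c - f], of the first and
    second derivatives of [f], of [D] and of the first derivatives of [D]. *)
Definition jtest (w f1 f2 f11 f12 f22 D D1 D2 : jet2) : jet2 :=
  jmul (jexp w 12)
    (jadd (jmul (jmul D D) (jquad f11 f12 f22 f1 f2))
          (jmul (jcst (1 / 512)) (jmul (jmul w w) (jquad f11 f12 f22 D1 D2)))).

(** Up to a power of w and a nonnegative remainder, this is the Laplacian of the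
    test function at a critical point.  With [o] standing for w, [e] for the length of grad f
    and (in an orthonormal basis directed by grad f) [u1], [u2] for the gradient
    of log rho and [b1], [b2] for B, the arguments are
    [G = e ^+ 2], [yi = w * e * ui], [zi = w * e * bi],
    [P = w ^+ 2 * (u1 ^+ 2 + u2 ^+ 2)], and [k] is a component of the trace-free
    Hessian of log rho, shifted so as to complete a square. *)
Definition reduced_form (o G y1 z1 k P y2 z2 : R) : R :=
  4 * o ^+ 2 - 84 * (o * G) - 36 * (o * y1) - o * P + 182 * G ^+ 2
  + 256 * (G * y1) - 56 * (G * z1) + 2 * (G * k)
  + 235 / 2 * y1 ^+ 2 + 211 / 2 * y2 ^+ 2 - 40 * (y1 * z1) - 40 * (y2 * z2)
  + 8 * z1 ^+ 2 + 8 * z2 ^+ 2 - y1 * P + 13 / 32 * P ^+ 2 + 1 / 32 * k ^+ 2.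

(** Completing squares shows that the form is at least
    G^2/2 + P^2/8 - 700 o^2. *)
Lemma reduced_form_bound o G y1 z1 k P y2 z2 : 0 <= o -> 0 <= G -> 0 <= P ->
  reduced_form o G y1 z1 k P y2 z2 <= 0 -> G + P / 32 <= 100 * o.
Proof.
move=> o0 G0 P0; rewrite /reduced_form => F.
have H : 1 / 2 * G ^+ 2 + 1 / 8 * P ^+ 2 <= 700 * o ^+ 2.
  (* The squares come from a Cholesky decomposition of the difference; the last
     of them, about (G - 25.6 o)^2, is a combination of h7 and h8. *)
  have h1 := sqr_ge0 (k + 32 * G).
  have h2 := sqr_ge0 (P - 16 / 9 * y1 - 16 / 9 * o).
  have h3 := sqr_ge0 (z2 - 5 / 2 * y2).
  have h4 := sqr_ge0 y2.
  have h5 := sqr_ge0 (z1 - 5 / 2 * y1 - 7 / 2 * G).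
  have h6 := sqr_ge0 (1199 * y1 + 1044 * G - 340 * o).
  have h7 := sqr_ge0 (G - 25 * o).
  have h8 := sqr_ge0 (G - 26 * o).
  have h9 := sqr_ge0 o.
  lra.
have GP := sqr_ge0 (G - P); have o2 := sqr_ge0 o.
have G2 := sqr_ge0 G; have P2 := sqr_ge0 P.
suff : (G + P / 32) ^+ 2 <= (100 * o) ^+ 2.
  by apply: contraTT; rewrite -!ltNge => N; rewrite ltrXn2r ?gt_eqF// ?nnegrE; lra.
lra.
Qed.

(** Bochner's formulas for E and Phi, as one polynomial identity.  The basis is
    orthonormal for the Calabi metric and directed by grad f, whose length is
    [e].  The third derivatives [a], [b], [c], [d] of [f] (with 0 to 3 indices
    equal to 2) are parametrized by the gradient [u1], [u2] of log rho and by
    the trace-free cubic form [b1], [b2]; the covariant Hessian of log rho has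
    trace [- Ph] by the differential equation, and its trace-free part is [t1],
    [t2].  The [mi] are the fourth derivatives of [f], which enter only through
    the second derivatives of the determinant; its third derivatives enter only
    through the two derivatives of the differential equation.  The sum on the
    left is the Laplace-Beltrami operator applied to the test function. *)
Lemma test_jet_identity (w e u1 u2 b1 b2 t1 t2 a b c d m0 m1 m2 m3 m4
    D1 D2 D11 D12 D22 D111 D122 D112 D222 : R) :
  a = - 2 * b1 - 3 * u1 -> b = - 2 * b2 - u2 ->
  c = 2 * b1 - u1 -> d = 2 * b2 - 3 * u2 ->
  D1 = - 4 * u1 -> D2 = - 4 * u2 ->
  let Ph := u1 ^+ 2 + u2 ^+ 2 in
  D11 = D1 ^+ 2 - 4 * (t1 - Ph / 2 + (a * u1 + b * u2) / 2) ->
  D12 = D1 * D2 - 4 * (t2 + (b * u1 + c * u2) / 2) ->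
  D22 = D2 ^+ 2 - 4 * (- t1 - Ph / 2 + (c * u1 + d * u2) / 2) ->
  D11 = m0 + m2 + 2 * a * c - 2 * b ^+ 2 ->
  D12 = m1 + m3 + a * d - b * c ->
  D22 = m2 + m4 + 2 * b * d - 2 * c ^+ 2 ->
  4 * (D1 * (D11 + D22) + (c * D11 - 2 * b * D12 + a * D22) + D111 + D122) =
  7 * (c * D1 ^+ 2 - 2 * b * D1 * D2 + a * D2 ^+ 2 + 2 * D1 * D11 + 2 * D2 * D12) ->
  4 * (D2 * (D11 + D22) + (d * D11 - 2 * c * D12 + b * D22) + D112 + D222) =
  7 * (d * D1 ^+ 2 - 2 * c * D1 * D2 + b * D2 ^+ 2 + 2 * D1 * D12 + 2 * D2 * D22) ->
  let S1 := jtest (w, - e, - 1) (e, 1, a) (0, 0, b) (1, a, m0) (0, b, m1)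
              (1, c, m2) (1, D1, D11) (D1, D11, D111) (D2, D12, D112) in
  let S2 := jtest (w, 0, - 1) (e, 0, c) (0, 1, d) (1, b, m2) (0, c, m3)
              (1, d, m4) (1, D2, D22) (D1, D12, D122) (D2, D22, D222) in
  let x1 := - 16 * e - 13 * w * u1 in let x2 := - 13 * w * u2 in
  let k1 := 2 * w * t1 + u1 * x1 - u2 * x2 in
  let k2 := 2 * w * t2 + u1 * x2 + u2 * x1 in
  S1.2 + S2.2 + 2 * (u1 * S1.1.2 + u2 * S2.1.2) =
  w ^+ 12 * (reduced_form w (e ^+ 2) (w * e * u1) (w * e * b1) (w * k1) (w ^+ 2 * Ph)
                  (w * e * u2) (w * e * b2)
             + 1 / 32 * w ^+ 2 * k2 ^+ 2
             + 1 / 8 * w ^+ 4 * Ph * (b1 ^+ 2 + b2 ^+ 2)).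
Proof.
move=> Ea Eb Ec Ed ED1 ED2 Ph E11 E12 E22 M11 M12 M22 P1 P2.
have {M11}M0 : m0 = D11 - m2 - 2 * a * c + 2 * b ^+ 2 by rewrite M11; ring.
have {M12}M3 : m3 = D12 - m1 - a * d + b * c by rewrite M12; ring.
have {M22}M4 : m4 = D22 - m2 - 2 * b * d + 2 * c ^+ 2 by rewrite M22; ring.
have E3 : D122 = 7 / 4 * (c * D1 ^+ 2 - 2 * b * D1 * D2 + a * D2 ^+ 2
   + 2 * D1 * D11 + 2 * D2 * D12) - D1 * (D11 + D22)
   - (c * D11 - 2 * b * D12 + a * D22) - D111 by lra.
have E5 : D222 = 7 / 4 * (d * D1 ^+ 2 - 2 * c * D1 * D2 + b * D2 ^+ 2
   + 2 * D1 * D12 + 2 * D2 * D22) - D2 * (D11 + D22)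
   - (d * D11 - 2 * c * D12 + b * D22) - D112 by lra.
rewrite /jtest /jquad /jexp /jmul /jadd /jcst /= E3 E5 M0 M3 M4 E11 E12 E22.
rewrite /reduced_form /Ph ED1 ED2 Ea Eb Ec Ed.
rewrite (exprD w 12 2) (exprD w 12 1).
move: (w ^+ 12) => p.
by field; rewrite ?pnatr_eq0.
Qed.

(** At a maximum the left side of [test_jet_identity] is nonpositive, and the
    remainder on its right side is nonnegative.  The variables of that identity
    are recovered from the derivatives of [f] by solving linear equations. *)
Lemma critical_jet_bound (w e a b c d m0 m1 m2 m3 m4
    D1 D2 D11 D12 D22 D111 D122 D112 D222 : R) :
  0 < w -> D1 = a + c -> D2 = b + d ->
  D11 = m0 + m2 + 2 * a * c - 2 * b ^+ 2 ->
  D12 = m1 + m3 + a * d - b * c ->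
  D22 = m2 + m4 + 2 * b * d - 2 * c ^+ 2 ->
  4 * (D11 + D22) = 7 * (D1 ^+ 2 + D2 ^+ 2) ->
  4 * (D1 * (D11 + D22) + (c * D11 - 2 * b * D12 + a * D22) + D111 + D122) =
  7 * (c * D1 ^+ 2 - 2 * b * D1 * D2 + a * D2 ^+ 2 + 2 * D1 * D11 + 2 * D2 * D12) ->
  4 * (D2 * (D11 + D22) + (d * D11 - 2 * c * D12 + b * D22) + D112 + D222) =
  7 * (d * D1 ^+ 2 - 2 * c * D1 * D2 + b * D2 ^+ 2 + 2 * D1 * D12 + 2 * D2 * D22) ->
  let S1 := jtest (w, - e, - 1) (e, 1, a) (0, 0, b) (1, a, m0) (0, b, m1)
              (1, c, m2) (1, D1, D11) (D1, D11, D111) (D2, D12, D112) in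
  let S2 := jtest (w, 0, - 1) (e, 0, c) (0, 1, d) (1, b, m2) (0, c, m3)
              (1, d, m4) (1, D2, D22) (D1, D12, D122) (D2, D22, D222) in
  S1.1.2 = 0 -> S2.1.2 = 0 -> S1.2 <= 0 -> S2.2 <= 0 ->
  e ^+ 2 + w ^+ 2 * (D1 ^+ 2 + D2 ^+ 2) / 512 <= 100 * w.
Proof.
move=> w0 E1 E2 E11 E12 E22 P0 P1 P2 S1 S2 S1z S2z S1n S2n.
pose u1 := - D1 / 4; pose u2 := - D2 / 4; pose Ph := u1 ^+ 2 + u2 ^+ 2.
pose b1 := - (a + 3 * u1) / 2; pose b2 := - (b + u2) / 2.
pose t1 := (D1 ^+ 2 - D11) / 4 - (a * u1 + b * u2) / 2 + Ph / 2.
pose t2 := (D1 * D2 - D12) / 4 - (b * u1 + c * u2) / 2.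
have F4 : (4 : R) != 0 by rewrite pnatr_eq0.
have F2 : (2 : R) != 0 by rewrite pnatr_eq0.
have Ea : a = - 2 * b1 - 3 * u1 by rewrite /b1; field.
have Eb : b = - 2 * b2 - u2 by rewrite /b2; field.
have Ec : c = 2 * b1 - u1 by rewrite /b1 /u1 E1; field.
have Ed : d = 2 * b2 - 3 * u2 by rewrite /b2 /u2 E2; field.
have ED1 : D1 = - 4 * u1 by rewrite /u1; field.
have ED2 : D2 = - 4 * u2 by rewrite /u2; field.
have H11 : D11 = D1 ^+ 2 - 4 * (t1 - Ph / 2 + (a * u1 + b * u2) / 2).
  by rewrite /t1 /Ph /u1 /u2; field.
have H12 : D12 = D1 * D2 - 4 * (t2 + (b * u1 + c * u2) / 2).
  by rewrite /t2 /u1 /u2; field.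
have H22 : D22 = D2 ^+ 2 - 4 * (- t1 - Ph / 2 + (c * u1 + d * u2) / 2).
  have -> : D22 = 7 / 4 * (D1 ^+ 2 + D2 ^+ 2) - D11 by lra.
  by rewrite /t1 /Ph /u1 /u2 E1 E2; field.
have := @test_jet_identity w e u1 u2 b1 b2 t1 t2 a b c d m0 m1 m2 m3 m4
  D1 D2 D11 D12 D22 D111 D122 D112 D222 Ea Eb Ec Ed ED1 ED2 H11 H12 H22
  E11 E12 E22 P1 P2.
cbv zeta; rewrite -/S1 -/S2 S1z S2z !mulr0 addr0 mulr0 addr0 => S.
move: S; set k1 := 2 * w * t1 + _ - _; set k2 := 2 * w * t2 + _ + _ => S.
have Ph0 : 0 <= Ph by rewrite addr_ge0 ?sqr_ge0.
have F0 : reduced_form w (e ^+ 2) (w * e * u1) (w * e * b1) (w * k1) (w ^+ 2 * Ph)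
               (w * e * u2) (w * e * b2) <= 0.
  have : S1.2 + S2.2 <= 0 by rewrite -oppr_ge0 opprD addr_ge0// oppr_ge0.
  rewrite S pmulr_rle0 ?exprn_gt0// => H.
  have Q1 : 0 <= 1 / 32 * w ^+ 2 * k2 ^+ 2.
    by rewrite mulr_ge0 ?sqr_ge0// mulr_ge0 ?sqr_ge0//; lra.
  have Q2 : 0 <= 1 / 8 * w ^+ 4 * Ph * (b1 ^+ 2 + b2 ^+ 2).
    rewrite mulr_ge0 ?addr_ge0 ?sqr_ge0// mulr_ge0//.
    by rewrite mulr_ge0 ?exprn_ge0// ?ltW//; lra.
  move: H Q1 Q2; rewrite -/Ph; set F := reduced_form _ _ _ _ _ _ _ _; lra.
have := reduced_form_bound (ltW w0) (sqr_ge0 e) (mulr_ge0 (sqr_ge0 w) Ph0) F0.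
suff -> : w ^+ 2 * (D1 ^+ 2 + D2 ^+ 2) / 512 = w ^+ 2 * Ph / 32 by [].
by rewrite ED1 ED2 /Ph; field; rewrite ?pnatr_eq0.
Qed.

End Jets.

(** * Two-jets of the test function *)

Section JetsOfFunctions.
Context {R : realType}.
Implicit Types (f g h a b c p q r : 'rV[R]_2 -> R) (x y v : 'rV[R]_2).
Variable Omega : set 'rV[R]_2.
Hypothesis openO : open Omega.
Local Notation smooth := (smooth_on Omega).

Definition jet v g x : jet2 := (g x, 'D_v g x, 'D_v ('D_v g) x).

Lemma jet_cst v (c : R) x : jet v (fun=> c) x = jcst c.
Proof.
rewrite /jet /jcst; congr (_, _, _); first by rewrite derive_cst.
have -> : 'D_v (fun=> c) = cst 0 by apply/funext => y; rewrite derive_cst.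
by rewrite derive_cst.
Qed.

Lemma jet_add v g h x : smooth g -> smooth h -> Omega x ->
  jet v (fun y => g y + h y) x = jadd (jet v g x) (jet v h x).
Proof.
move=> sg sh Ox; have E y := @derive_add _ _ openO v g h y sg sh.
rewrite /jet /jadd E//; congr (_, _, _).
rewrite (eq_on_derive openO v E Ox).
exact: (derive_add openO v (smooth_derive openO v sg) (smooth_derive openO v sh)).
Qed.

Lemma jet_mul v g h x : smooth g -> smooth h -> Omega x ->
  jet v (fun y => g y * h y) x = jmul (jet v g x) (jet v h x).
Proof.
move=> sg sh Ox; have E y := @derive_mul _ _ openO v g h y sg sh.
rewrite /jet /jmul E//; congr (_, _, _).
rewrite (eq_on_derive openO v E Ox).
have sDg := smooth_derive openO v sg; have sDh := smooth_derive openO v sh.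
rewrite (derive_add openO v (smooth_mul openO sDg sh) (smooth_mul openO sg sDh) Ox).
rewrite (derive_mul openO v sDg sh Ox) (derive_mul openO v sg sDh Ox).
move: (g x) (h x) ('D_v g x) ('D_v h x) ('D_v ('D_v g) x) ('D_v ('D_v h) x).
by move=> *; ring.
Qed.

Lemma smooth_exp g n : smooth g -> smooth (fun y => g y ^+ n).
Proof.
move=> sg; elim: n => [|n IH]; first exact: smooth_cst.
have -> : (fun y => g y ^+ n.+1) = (fun y => g y * g y ^+ n).
  by apply/funext => y; rewrite exprS.
exact: (smooth_mul openO sg IH).
Qed.

Lemma jet_exp v g x n : smooth g -> Omega x ->
  jet v (fun y => g y ^+ n.+2) x = jexp (jet v g x) n.
Proof.
move=> sg Ox; elim: n => [|n IH].
  have -> : (fun y => g y ^+ 2) = (fun y => g y * g y).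
    by apply/funext => y; rewrite expr2.
  rewrite (jet_mul v sg sg Ox) /jet /jmul /jexp; congr (_, _, _); ring.
have -> : (fun y => g y ^+ n.+3) = (fun y => g y * g y ^+ n.+2).
  by apply/funext => y; rewrite exprS.
rewrite (jet_mul v sg (smooth_exp n.+2 sg) Ox) IH /jet /jmul /jexp.
rewrite !exprS -!natr1; congr (_, _, _); ring.
Qed.

Lemma derive_trinomial v a b c p q r x : smooth a -> smooth b -> smooth c ->
  smooth p -> smooth q -> smooth r -> Omega x ->
  'D_v (fun y => a y * p y + (- 2) * (b y * q y) + c y * r y) x =
  'D_v a x * p x + a x * 'D_v p x - 2 * ('D_v b x * q x + b x * 'D_v q x)
  + ('D_v c x * r x + c x * 'D_v r x).
Proof.
move=> sa sb sc sp sq sr Ox.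
have tb := smooth_mul openO (smooth_cst (- 2)) (smooth_mul openO sb sq).
have ta := smooth_mul openO sa sp; have tc := smooth_mul openO sc sr.
apply: (etrans (derive_add openO v (smooth_add openO ta tb) tc Ox)).
congr (_ + _); last exact: (derive_mul openO v sc sr Ox).
apply: (etrans (derive_add openO v ta tb Ox)).
congr (_ + _); first exact: (derive_mul openO v sa sp Ox).
apply: (etrans (derive_cmul openO v (- 2) (smooth_mul openO sb sq) Ox)).
by rewrite mulNr; congr (- (2 * _)); exact: (derive_mul openO v sb sq Ox).
Qed.

Lemma derive_mul_mixed v w g h x : smooth g -> smooth h -> Omega x ->
  'D_w ('D_v (fun y => g y * h y)) x =
  'D_w ('D_v g) x * h x + 'D_v g x * 'D_w h x
  + ('D_w g x * 'D_v h x + g x * 'D_w ('D_v h) x).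
Proof.
move=> sg sh Ox; have E y := @derive_mul _ _ openO v g h y sg sh.
rewrite (eq_on_derive openO w E Ox).
have sDg := smooth_derive openO v sg; have sDh := smooth_derive openO v sh.
apply: (etrans (derive_add openO w (smooth_mul openO sDg sh)
  (smooth_mul openO sg sDh) Ox)).
congr (_ + _); first exact: (derive_mul openO w sDg sh Ox).
exact: (derive_mul openO w sg sDh Ox).
Qed.

(** Jets along a line do not contain mixed derivatives; the one of the Hessian
    determinant is computed by this formula. *)
Lemma derive_det_mixed v w a b c x : smooth a -> smooth b -> smooth c ->
  Omega x ->
  'D_w ('D_v (fun y => a y * c y + (-1) * (b y * b y))) x =
  'D_w ('D_v a) x * c x + 'D_v a x * 'D_w c x
  + ('D_w a x * 'D_v c x + a x * 'D_w ('D_v c) x)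
  - 2 * (b x * 'D_w ('D_v b) x + 'D_v b x * 'D_w b x).
Proof.
move=> sa sb sc Ox.
have sac := smooth_mul openO sa sc; have sbb := smooth_mul openO sb sb.
have snb := smooth_mul openO (smooth_cst (-1)) sbb.
have E y := @derive_add _ _ openO v _ _ y sac snb.
rewrite (eq_on_derive openO w E Ox).
have sDac := smooth_derive openO v sac; have sDnb := smooth_derive openO v snb.
apply: (etrans (derive_add openO w sDac sDnb Ox)).
congr (_ + _); first exact: (derive_mul_mixed v w sa sc Ox).
have F y := @derive_cmul _ _ openO v (-1) _ y sbb.
rewrite (eq_on_derive openO w F Ox).
apply: (etrans (derive_cmul openO w (-1) (smooth_derive openO v sbb) Ox)).
rewrite (derive_mul_mixed v w sb sb Ox).
move: (b x) ('D_v b x) ('D_w b x) ('D_w ('D_v b) x) => *; ring.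
Qed.

End JetsOfFunctions.

Section Frame.
Context {R : realType}.
Implicit Types (f g h : 'rV[R]_2 -> R) (x y v : 'rV[R]_2).

(** The expressions below are written with sums and products only, and with the
    constants -1 and -2 as factors, so that [jadd] and [jmul] compute their
    jets. *)
Definition frame_det (e1 e2 : 'rV[R]_2) f y :=
  'D_e1 ('D_e1 f) y * 'D_e2 ('D_e2 f) y +
  (-1) * ('D_e2 ('D_e1 f) y * 'D_e2 ('D_e1 f) y).

(** The Hessian determinant times the squared length of grad [h] in the Calabi
    metric, which is polynomial in the derivatives of [f] and [h]. *)
Definition frame_quad (e1 e2 : 'rV[R]_2) f h y :=
  'D_e2 ('D_e2 f) y * ('D_e1 h y * 'D_e1 h y)
  + (- 2) * ('D_e2 ('D_e1 f) y * ('D_e1 h y * 'D_e2 h y))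
  + 'D_e1 ('D_e1 f) y * ('D_e2 h y * 'D_e2 h y).

Definition frame_test (C : R) (e1 e2 : 'rV[R]_2) f y :=
  (C - f y) ^+ 14 *
  ((frame_det e1 e2 f y * frame_det e1 e2 f y) * frame_quad e1 e2 f f y +
   1 / 512 * (((C - f y) * (C - f y)) *
              frame_quad e1 e2 f (frame_det e1 e2 f) y)).

(** The cofactor matrix of the Hessian of [f] contracted with the Hessian of
    [h]. *)
Definition frame_lap (e1 e2 : 'rV[R]_2) f h y :=
  'D_e2 ('D_e2 f) y * 'D_e1 ('D_e1 h) y
  + (- 2) * ('D_e2 ('D_e1 f) y * 'D_e2 ('D_e1 h) y)
  + 'D_e1 ('D_e1 f) y * 'D_e2 ('D_e2 h) y.

Variable Omega : set 'rV[R]_2.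
Hypothesis openO : open Omega.
Local Notation smooth := (smooth_on Omega).
Variables (f : 'rV[R]_2 -> R) (e1 e2 : 'rV[R]_2).
Hypothesis sf : smooth f.
Let sD v h (sh : smooth h) : smooth ('D_v h) := smooth_derive openO v sh.

Lemma smooth_frame_det : smooth (frame_det e1 e2 f).
Proof.
have s12 := sD e2 (sD e1 sf).
exact: (smooth_add openO (smooth_mul openO (sD e1 (sD e1 sf)) (sD e2 (sD e2 sf)))
  (smooth_mul openO (smooth_cst (-1)) (smooth_mul openO s12 s12))).
Qed.

Lemma smooth_frame_quad h : smooth h -> smooth (frame_quad e1 e2 f h).
Proof.
move=> sh; have s1 := sD e1 sh; have s2 := sD e2 sh.
apply: (smooth_add openO); first apply: (smooth_add openO).
- exact: (smooth_mul openO (sD e2 (sD e2 sf)) (smooth_mul openO s1 s1)).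
- exact: (smooth_mul openO (smooth_cst (-2)) (smooth_mul openO (sD e2 (sD e1 sf))
           (smooth_mul openO s1 s2))).
- exact: (smooth_mul openO (sD e1 (sD e1 sf)) (smooth_mul openO s2 s2)).
Qed.

Lemma jet_quad v h x : smooth h -> Omega x ->
  jet v (frame_quad e1 e2 f h) x =
  jquad (jet v ('D_e1 ('D_e1 f)) x) (jet v ('D_e2 ('D_e1 f)) x)
        (jet v ('D_e2 ('D_e2 f)) x) (jet v ('D_e1 h) x) (jet v ('D_e2 h) x).
Proof.
move=> sh Ox; have s1 := sD e1 sh; have s2 := sD e2 sh.
have s11 := sD e1 (sD e1 sf); have s12 := sD e2 (sD e1 sf).
have s22 := sD e2 (sD e2 sf).
have m11 := smooth_mul openO s1 s1; have m12 := smooth_mul openO s1 s2.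
have m22 := smooth_mul openO s2 s2.
have q12 := smooth_mul openO s12 m12.
have t22 := smooth_mul openO s22 m11; have t11 := smooth_mul openO s11 m22.
have t12 := smooth_mul openO (smooth_cst (-2)) q12.
rewrite /frame_quad (jet_add openO v (smooth_add openO t22 t12) t11 Ox).
rewrite (jet_add openO v t22 t12 Ox) (jet_mul openO v s22 m11 Ox).
rewrite (jet_mul openO v s1 s1 Ox) (jet_mul openO v (smooth_cst (-2)) q12 Ox).
rewrite (jet_mul openO v s12 m12 Ox) (jet_mul openO v s1 s2 Ox).
rewrite (jet_mul openO v s11 m22 Ox) (jet_mul openO v s2 s2 Ox).
by rewrite (jet_cst v (-2) x).
Qed.

Lemma derive_lap v h x : smooth h -> Omega x ->
  'D_v (frame_lap e1 e2 f h) x =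
  'D_v ('D_e2 ('D_e2 f)) x * 'D_e1 ('D_e1 h) x
  + 'D_e2 ('D_e2 f) x * 'D_v ('D_e1 ('D_e1 h)) x
  - 2 * ('D_v ('D_e2 ('D_e1 f)) x * 'D_e2 ('D_e1 h) x
         + 'D_e2 ('D_e1 f) x * 'D_v ('D_e2 ('D_e1 h)) x)
  + ('D_v ('D_e1 ('D_e1 f)) x * 'D_e2 ('D_e2 h) x
     + 'D_e1 ('D_e1 f) x * 'D_v ('D_e2 ('D_e2 h)) x).
Proof.
move=> sh Ox; have s11 := sD e1 (sD e1 sf); have s12 := sD e2 (sD e1 sf).
have s22 := sD e2 (sD e2 sf); have h11 := sD e1 (sD e1 sh).
have h12 := sD e2 (sD e1 sh); have h22 := sD e2 (sD e2 sh).
exact: (derive_trinomial openO v s22 s12 s11 h11 h12 h22 Ox).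
Qed.

Lemma smooth_frame_lap h : smooth h -> smooth (frame_lap e1 e2 f h).
Proof.
move=> sh; apply: (smooth_add openO); first apply: (smooth_add openO).
- exact: (smooth_mul openO (sD e2 (sD e2 sf)) (sD e1 (sD e1 sh))).
- exact: (smooth_mul openO (smooth_cst (-2))
           (smooth_mul openO (sD e2 (sD e1 sf)) (sD e2 (sD e1 sh)))).
- exact: (smooth_mul openO (sD e1 (sD e1 sf)) (sD e2 (sD e2 sh))).
Qed.

Lemma jet_det v x : Omega x ->
  jet v (frame_det e1 e2 f) x =
  jadd (jmul (jet v ('D_e1 ('D_e1 f)) x) (jet v ('D_e2 ('D_e2 f)) x))
       (jmul (jcst (-1)) (jmul (jet v ('D_e2 ('D_e1 f)) x)
                               (jet v ('D_e2 ('D_e1 f)) x))).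
Proof.
move=> Ox; have s11 := sD e1 (sD e1 sf); have s12 := sD e2 (sD e1 sf).
have s22 := sD e2 (sD e2 sf); have q := smooth_mul openO s12 s12.
have t := smooth_mul openO (smooth_cst (-1)) q.
rewrite /frame_det (jet_add openO v (smooth_mul openO s11 s22) t Ox).
rewrite (jet_mul openO v s11 s22 Ox) (jet_mul openO v (smooth_cst (-1)) q Ox).
by rewrite (jet_mul openO v s12 s12 Ox) (jet_cst v (-1) x).
Qed.

Lemma jet_level v (C : R) x : Omega x ->
  jet v (fun y => C - f y) x = (C - f x, - 'D_v f x, - 'D_v ('D_v f) x).
Proof.
move=> Ox; have E : (fun y => C - f y) = (fun y => C + (-1) * f y).
  by apply/funext => y; rewrite mulN1r.
have s := smooth_mul openO (smooth_cst (-1)) sf.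
rewrite E (jet_add openO v (smooth_cst C) s Ox) (jet_cst v C x).
rewrite (jet_mul openO v (smooth_cst (-1)) sf Ox) (jet_cst v (-1) x).
by rewrite /jet /jadd /jmul /jcst; congr (_, _, _); ring.
Qed.

Lemma smooth_level (C : R) : smooth (fun y => C - f y).
Proof.
have E : (fun y => C - f y) = (fun y => C + (-1) * f y).
  by apply/funext => y; rewrite mulN1r.
by rewrite E; exact: (smooth_add openO (smooth_cst C)
  (smooth_mul openO (smooth_cst (-1)) sf)).
Qed.

Lemma frame_test_smooth_jet (C : R) v x : Omega x ->
  smooth (frame_test C e1 e2 f) /\
  jet v (frame_test C e1 e2 f) x =
  jtest (C - f x, - 'D_v f x, - 'D_v ('D_v f) x)
    (jet v ('D_e1 f) x) (jet v ('D_e2 f) x)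
    (jet v ('D_e1 ('D_e1 f)) x) (jet v ('D_e2 ('D_e1 f)) x)
    (jet v ('D_e2 ('D_e2 f)) x) (jet v (frame_det e1 e2 f) x)
    (jet v ('D_e1 (frame_det e1 e2 f)) x) (jet v ('D_e2 (frame_det e1 e2 f)) x).
Proof.
move=> Ox; have sw := smooth_level C; have sd := smooth_frame_det.
have p14 := smooth_exp openO 14 sw.
have dd := smooth_mul openO sd sd; have ww := smooth_mul openO sw sw.
have qf := smooth_frame_quad sf; have qd := smooth_frame_quad sd.
have t1 := smooth_mul openO dd qf; have q2 := smooth_mul openO ww qd.
have t2 := smooth_mul openO (smooth_cst (1 / 512)) q2.
have t := smooth_add openO t1 t2.
split; first exact: (smooth_mul openO p14 t).
rewrite /frame_test (jet_mul openO v p14 t Ox) (jet_exp openO v 12 sw Ox).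
rewrite (jet_add openO v t1 t2 Ox) (jet_mul openO v dd qf Ox).
rewrite (jet_mul openO v sd sd Ox).
rewrite (jet_mul openO v (smooth_cst (1 / 512)) q2 Ox).
rewrite (jet_mul openO v ww qd Ox) (jet_mul openO v sw sw Ox).
by rewrite (jet_cst v (1 / 512) x) (jet_level v C Ox) (jet_quad v sf Ox)
  (jet_quad v sd Ox).
Qed.

End Frame.

(** * The bound at a maximum, in a normal frame *)

(** The bound of [critical_jet_bound] with one variable for each derivative that
    the product rule produces, in the order of differentiation in which it
    arises; the first equations say that the Hessian is the identity, that the
    second vector is tangent to the level line, and which derivatives agree
    by symmetry. *)
Lemma critical_derivatives_bound (R : realType) (w f1 f2 f11 f12 g12 f22
    f111 f112 f122 f222 g112 g121 g122 m0 m1 m2 m3 m4 n1 n2 n3 n4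
    D D1 D2 D11 D12 D21 D22 D111 D112 D122 D222 E112 E121 E122
    S Sa Saa Sb Sbb Q Qa Qaa Qb Qbb L La Lb : R) :
  0 < w -> f11 = 1 -> f12 = 0 -> f22 = 1 -> f2 = 0 ->
  g12 = f12 -> g121 = f112 -> g112 = f112 -> g122 = f122 ->
  n1 = m1 -> n2 = m2 -> n3 = m3 -> D21 = D12 -> E112 = D112 -> E122 = D122 ->
  L = f22 * D11 + (- 2) * (f12 * D12) + f11 * D22 ->
  Q = f22 * (D1 * D1) + (- 2) * (f12 * (D1 * D2)) + f11 * (D2 * D2) ->
  4 * (D * L) = 7 * Q ->
  4 * (D1 * L + D * La) = 7 * Qa -> 4 * (D2 * L + D * Lb) = 7 * Qb ->
  La = g122 * D11 + f22 * D111 - 2 * (g121 * D12 + f12 * E121)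
       + (f111 * D22 + f11 * E122) ->
  Lb = f222 * D11 + f22 * D112 - 2 * (f122 * D12 + f12 * D122)
       + (f112 * D22 + f11 * D222) ->
  (Q, Qa, Qaa) = jquad (f11, f111, m0) (f12, g121, n1) (f22, g122, n2)
                   (D1, D11, D111) (D2, D21, E112) ->
  (Q, Qb, Qbb) = jquad (f11, f112, m2) (f12, f122, m3) (f22, f222, m4)
                   (D1, D12, D122) (D2, D22, D222) ->
  D12 = m1 * f22 + f111 * f222 + (f112 * g122 + f11 * n3)
        - 2 * (f12 * n4 + g121 * f122) ->
  (D, D1, D11) = jadd (jmul (f11, f111, m0) (f22, g122, n2))
                  (jmul (jcst (-1)) (jmul (f12, g121, n1) (f12, g121, n1))) ->
  (D, D2, D22) = jadd (jmul (f11, f112, m2) (f22, f222, m4))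
                  (jmul (jcst (-1)) (jmul (f12, f122, m3) (f12, f122, m3))) ->
  (S, Sa, Saa) = jtest (w, - f1, - f11) (f1, f11, f111) (f2, g12, g112)
    (f11, f111, m0) (f12, g121, n1) (f22, g122, n2)
    (D, D1, D11) (D1, D11, D111) (D2, D21, E112) ->
  (S, Sb, Sbb) = jtest (w, - f2, - f22) (f1, f12, f122) (f2, f22, f222)
    (f11, f112, m2) (f12, f122, m3) (f22, f222, m4)
    (D, D2, D22) (D1, D12, D122) (D2, D22, D222) ->
  Sa = 0 -> Sb = 0 -> Saa <= 0 -> Sbb <= 0 ->
  f1 ^+ 2 + w ^+ 2 * (D1 ^+ 2 + D2 ^+ 2) / 512 <= 100 * w.
Proof.
move=> w0 -> -> -> -> -> -> -> -> -> -> -> -> -> -> -> {L} EQ PDE PDa PDb ELa ELb.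
move=> [_ EQa _] [_ EQb _] E12 [ED ED1 ED11] [_ ED2 ED22] JS1 JS2.
move=> Sa0 Sb0 Saa0 Sbb0.
have {}ED : D = 1 by rewrite ED; ring.
rewrite ED oppr0 in PDE PDa PDb JS1 JS2.
apply: (@critical_jet_bound _ w f1 f111 f112 f122 f222 m0 m1 m2 m3 m4
  D1 D2 D11 D12 D22 D111 D122 D112 D222) => //.
- by rewrite ED1; ring.
- by rewrite ED2; ring.
- by rewrite ED11; ring.
- by rewrite E12; ring.
- by rewrite ED22; ring.
- by move: PDE; rewrite EQ; lra.
- by move: PDa; rewrite EQa ELa; lra.
- by move: PDb; rewrite EQb ELb; lra.
- by rewrite -JS1.
- by rewrite -JS2.
- by rewrite -JS1.
- by rewrite -JS2.
Qed.

Section CriticalPoint.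
Context {R : realType}.
Implicit Types (g h : 'rV[R]_2 -> R) (x y v : 'rV[R]_2).
Variable Omega : set 'rV[R]_2.
Hypothesis openO : open Omega.
Local Notation smooth := (smooth_on Omega).
Variables (e1 e2 : 'rV[R]_2).
Let sD v h (sh : smooth h) : smooth ('D_v h) := smooth_derive openO v sh.

Lemma swap12 g y : smooth g -> Omega y ->
  'D_e1 ('D_e2 g) y = 'D_e2 ('D_e1 g) y.
Proof. by move=> sg Oy; exact: (schwarz openO e2 e1 sg Oy). Qed.

Lemma swap112 g y : smooth g -> Omega y ->
  'D_e1 ('D_e1 ('D_e2 g)) y = 'D_e2 ('D_e1 ('D_e1 g)) y.
Proof.
move=> sg Oy; apply: etrans (swap12 (sD e1 sg) Oy).
by apply: (eq_on_derive openO e1 _ Oy) => z; exact: swap12.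
Qed.

Lemma swap122 g y : smooth g -> Omega y ->
  'D_e1 ('D_e2 ('D_e2 g)) y = 'D_e2 ('D_e2 ('D_e1 g)) y.
Proof.
move=> sg Oy; apply: (etrans (swap12 (sD e2 sg) Oy)).
by apply: (eq_on_derive openO e2 _ Oy) => z; exact: swap12.
Qed.

Lemma swap1122 g y : smooth g -> Omega y ->
  'D_e1 ('D_e1 ('D_e2 ('D_e2 g))) y = 'D_e2 ('D_e2 ('D_e1 ('D_e1 g))) y.
Proof.
move=> sg Oy; apply: etrans (swap122 (sD e1 sg) Oy).
by apply: (eq_on_derive openO e1 _ Oy) => z; exact: swap122.
Qed.

Variable f : 'rV[R]_2 -> R.
Hypothesis sf : smooth f.
Let D := frame_det e1 e2 f.
Hypothesis pde : forall y, Omega y ->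
  4 * (D y * frame_lap e1 e2 f D y) = 7 * frame_quad e1 e2 f D y.

(** Only the numbers that are derivatives at [x] matter, and the lemma on those
    numbers applies: the first two derivatives of the test function along the
    frame come from its jets, and the two derivatives of the differential
    equation from [PD]. *)
Lemma critical_point_bound (C : R) x : Omega x ->
  'D_e1 ('D_e1 f) x = 1 -> 'D_e2 ('D_e1 f) x = 0 -> 'D_e2 ('D_e2 f) x = 1 ->
  'D_e2 f x = 0 -> 0 < C - f x ->
  (\forall y \near x, frame_test C e1 e2 f y <= frame_test C e1 e2 f x) ->
  'D_e1 f x ^+ 2 + (C - f x) ^+ 2 * ('D_e1 D x ^+ 2 + 'D_e2 D x ^+ 2) / 512
    <= 100 * (C - f x).
Proof.
move=> Ox f11 f12 f22 f2 w0 Hmax.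
have sDet : smooth D by exact: smooth_frame_det.
have [sS _] := frame_test_smooth_jet openO e1 e2 sf C e1 Ox.
have d1 := local_max_derive openO e1 sS Ox Hmax.
have d2 := local_max_derive openO e2 sS Ox Hmax.
have d11 := local_max_derive2 openO e1 sS Ox Hmax.
have d22 := local_max_derive2 openO e2 sS Ox Hmax.
have [_ J1] := frame_test_smooth_jet openO e1 e2 sf C e1 Ox.
have [_ J2] := frame_test_smooth_jet openO e1 e2 sf C e2 Ox.
have Det1 := jet_det openO e1 e2 sf e1 Ox.
have Det2 := jet_det openO e1 e2 sf e2 Ox.
rewrite -/D in J1 J2 Det1 Det2.
have b1 := swap12 (sD e1 sf) Ox; have b2 := swap112 sf Ox.
have c1 := swap122 sf Ox; have m1 := swap112 (sD e1 sf) Ox.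
have m2 := swap1122 sf Ox.
have m3 : 'D_e2 ('D_e1 ('D_e2 ('D_e2 f))) x = 'D_e2 ('D_e2 ('D_e2 ('D_e1 f))) x.
  by apply: (eq_on_derive openO e2 _ Ox) => z; exact: swap122.
have D12 := swap12 sDet Ox.
have D112 := swap112 sDet Ox; have D122 := swap122 sDet Ox.
have DM : 'D_e2 ('D_e1 D) x = _ := derive_det_mixed openO e1 e2
  (sD e1 (sD e1 sf)) (sD e2 (sD e1 sf)) (sD e2 (sD e2 sf)) Ox.
have P0 := pde Ox.
have PD v : 4 * ('D_v D x * frame_lap e1 e2 f D x
                 + D x * 'D_v (frame_lap e1 e2 f D) x) =
            7 * 'D_v (frame_quad e1 e2 f D) x.
  have sL := smooth_frame_lap openO e1 e2 sf sDet.
  have sQ := smooth_frame_quad openO e1 e2 sf sDet.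
  rewrite -(derive_mul openO v sDet sL Ox).
  rewrite -(derive_cmul openO v 4 (smooth_mul openO sDet sL) Ox).
  rewrite -(derive_cmul openO v 7 sQ Ox).
  exact: (eq_on_derive openO v pde Ox).
have Q1 := jet_quad openO e1 e2 sf e1 sDet Ox.
have Q2 := jet_quad openO e1 e2 sf e2 sDet Ox.
have L1 := derive_lap openO e1 e2 sf e1 sDet Ox.
have L2 := derive_lap openO e1 e2 sf e2 sDet Ox.
have g12 := swap12 sf Ox.
exact: (critical_derivatives_bound w0 f11 f12 f22 f2 g12 b1 b2 c1 m1 m2 m3
  D12 D112 D122 erefl erefl P0 (PD e1) (PD e2) L1 L2 Q1 Q2 DM Det1 Det2 J1 J2
  d1 d2 d11 d22).
Qed.
End CriticalPoint.

(** * Change of frame *)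

Section FrameChange.
Context {R : realType}.
Implicit Types (f g h : 'rV[R]_2 -> R) (x y v w : 'rV[R]_2).
Variable Omega : set 'rV[R]_2.
Hypothesis openO : open Omega.
Local Notation smooth := (smooth_on Omega).
Local Notation i0 := (delta_mx 0 0 : 'rV[R]_2).
Local Notation i1 := (delta_mx 0 1 : 'rV[R]_2).

Lemma derive2_partial v w h x : smooth h -> Omega x ->
  'D_w ('D_v h) x = v 0 0 * w 0 0 * 'D_i0 ('D_i0 h) x
    + (v 0 0 * w 0 1 + v 0 1 * w 0 0) * 'D_i1 ('D_i0 h) x
    + v 0 1 * w 0 1 * 'D_i1 ('D_i1 h) x.
Proof.
move=> sh Ox; have E y := @smooth_derive_partial _ _ openO h v y sh.
have s0 := smooth_derive openO i0 sh; have s1 := smooth_derive openO i1 sh.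
have c0 := smooth_mul openO (smooth_cst (v 0 0)) s0.
have c1 := smooth_mul openO (smooth_cst (v 0 1)) s1.
have alg (v0 v1 w0 w1 h00 h01 h10 h11 a b t : R) : h10 = h01 ->
    t = v0 * a + v1 * b -> a = w0 * h00 + w1 * h01 ->
    b = w0 * h10 + w1 * h11 ->
    t = v0 * w0 * h00 + (v0 * w1 + v1 * w0) * h01 + v1 * w1 * h11.
  by move=> -> -> -> ->; ring.
apply: (alg _ _ _ _ _ _ _ _ _ _ _ (schwarz openO i1 i0 sh Ox) _
  (smooth_derive_partial openO w s0 Ox) (smooth_derive_partial openO w s1 Ox)).
apply: (etrans (eq_on_derive openO w E Ox)).
apply: (etrans (derive_add openO w c0 c1 Ox)).
congr (_ + _); first exact: (derive_cmul openO w (v 0 0) s0 Ox).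
exact: (derive_cmul openO w (v 0 1) s1 Ox).
Qed.

Variables (f : 'rV[R]_2 -> R) (e1 e2 : 'rV[R]_2).
Hypothesis sf : smooth f.
Definition frame_orient := e1 0 0 * e2 0 1 - e1 0 1 * e2 0 0.
Local Notation delta := frame_orient.

(** The Hessian in the new basis is the old one multiplied by the matrix of the
    basis and its transpose. *)
Lemma frame_det_change x : Omega x ->
  frame_det e1 e2 f x = delta ^+ 2 * frame_det i0 i1 f x.
Proof.
move=> Ox.
have alg (p q r s a b c a' b' c' : R) :
  a = p * p * a' + (p * q + q * p) * b' + q * q * c' ->
  b = p * r * a' + (p * s + q * r) * b' + q * s * c' ->
  c = r * r * a' + (r * s + s * r) * b' + s * s * c' ->
  a * c + (-1) * (b * b) =
  (p * s - q * r) ^+ 2 * (a' * c' + (-1) * (b' * b')).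
  by move=> -> -> ->; ring.
exact: (alg _ _ _ _ _ _ _ _ _ _ (derive2_partial e1 e1 sf Ox)
  (derive2_partial e1 e2 sf Ox) (derive2_partial e2 e2 sf Ox)).
Qed.

(** The squared length of grad [h] does not depend on the basis, so the quadratic
    expression scales like the determinant. *)
Lemma frame_quad_change h x : smooth h -> Omega x ->
  frame_quad e1 e2 f h x = delta ^+ 2 * frame_quad i0 i1 f h x.
Proof.
move=> sh Ox.
have alg (p q r s a b c a' b' c' k l k' l' : R) :
  a = p * p * a' + (p * q + q * p) * b' + q * q * c' ->
  b = p * r * a' + (p * s + q * r) * b' + q * s * c' ->
  c = r * r * a' + (r * s + s * r) * b' + s * s * c' ->
  k = p * k' + q * l' -> l = r * k' + s * l' ->
  c * (k * k) + (- 2) * (b * (k * l)) + a * (l * l) =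
  (p * s - q * r) ^+ 2 *
    (c' * (k' * k') + (- 2) * (b' * (k' * l')) + a' * (l' * l')).
  by move=> -> -> -> -> ->; ring.
exact: (alg _ _ _ _ _ _ _ _ _ _ _ _ _ _ (derive2_partial e1 e1 sf Ox)
  (derive2_partial e1 e2 sf Ox) (derive2_partial e2 e2 sf Ox)
  (smooth_derive_partial openO e1 sh Ox) (smooth_derive_partial openO e2 sh Ox)).
Qed.

Lemma frame_lap_change h x : smooth h -> Omega x ->
  frame_lap e1 e2 f h x = delta ^+ 2 * frame_lap i0 i1 f h x.
Proof.
move=> sh Ox.
have alg (p q r s a b c a' b' c' k l m k' l' m' : R) :
  a = p * p * a' + (p * q + q * p) * b' + q * q * c' ->
  b = p * r * a' + (p * s + q * r) * b' + q * s * c' ->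
  c = r * r * a' + (r * s + s * r) * b' + s * s * c' ->
  k = p * p * k' + (p * q + q * p) * l' + q * q * m' ->
  l = p * r * k' + (p * s + q * r) * l' + q * s * m' ->
  m = r * r * k' + (r * s + s * r) * l' + s * s * m' ->
  c * k + (- 2) * (b * l) + a * m =
  (p * s - q * r) ^+ 2 * (c' * k' + (- 2) * (b' * l') + a' * m').
  by move=> -> -> -> -> -> ->; ring.
exact: (alg _ _ _ _ _ _ _ _ _ _ _ _ _ _ _ _ (derive2_partial e1 e1 sf Ox)
  (derive2_partial e1 e2 sf Ox) (derive2_partial e2 e2 sf Ox)
  (derive2_partial e1 e1 sh Ox)
  (derive2_partial e1 e2 sh Ox) (derive2_partial e2 e2 sh Ox)).
Qed.

Lemma derive_eq_cmul v (c : R) g h x : smooth h ->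
  (forall y, Omega y -> g y = c * h y) -> Omega x -> 'D_v g x = c * 'D_v h x.
Proof.
move=> sh E Ox.
exact: (etrans (eq_on_derive openO v E Ox) (derive_cmul openO v c sh Ox)).
Qed.

Lemma frame_quad_scale (c : R) g h x : smooth h ->
  (forall y, Omega y -> g y = c * h y) -> Omega x ->
  frame_quad i0 i1 f g x = c ^+ 2 * frame_quad i0 i1 f h x.
Proof.
move=> sh E Ox.
have alg (k l k' l' r s t : R) : k = c * k' -> l = c * l' ->
  r * (k * k) + (- 2) * (s * (k * l)) + t * (l * l) =
  c ^+ 2 * (r * (k' * k') + (- 2) * (s * (k' * l')) + t * (l' * l')).
  by move=> -> ->; ring.
exact: (alg _ _ _ _ _ _ _ (derive_eq_cmul i0 sh E Ox) (derive_eq_cmul i1 sh E Ox)).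
Qed.

Lemma frame_lap_scale (c : R) g h x : smooth h ->
  (forall y, Omega y -> g y = c * h y) -> Omega x ->
  frame_lap i0 i1 f g x = c * frame_lap i0 i1 f h x.
Proof.
move=> sh E Ox.
have D2 v w : 'D_w ('D_v g) x = c * 'D_w ('D_v h) x.
  apply: (derive_eq_cmul w (smooth_derive openO v sh) _ Ox) => y Oy.
  exact: (derive_eq_cmul v sh E Oy).
have alg (k l m k' l' m' r s t : R) : k = c * k' -> l = c * l' -> m = c * m' ->
  r * k + (- 2) * (s * l) + t * m =
  c * (r * k' + (- 2) * (s * l') + t * m').
  by move=> -> -> ->; ring.
exact: (alg _ _ _ _ _ _ _ _ _ (D2 i0 i0) (D2 i0 i1) (D2 i1 i1)).
Qed.

(** Two powers of the orientation come from the frame and four from the square of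
    the determinant, which is itself rescaled. *)
Lemma frame_quad_det_change x : Omega x ->
  frame_quad e1 e2 f (frame_det e1 e2 f) x =
  delta ^+ 6 * frame_quad i0 i1 f (frame_det i0 i1 f) x.
Proof.
move=> Ox; have sDe := smooth_frame_det openO e1 e2 sf.
have sDi := smooth_frame_det openO i0 i1 sf.
apply: (etrans (frame_quad_change sDe Ox)).
apply: (etrans (congr1 (fun z => _ * z) (frame_quad_scale sDi frame_det_change Ox))).
by rewrite -exprM mulrA -exprD.
Qed.

Lemma frame_test_change (C : R) x : Omega x ->
  frame_test C e1 e2 f x = delta ^+ 6 * frame_test C i0 i1 f x.
Proof.
move=> Ox.
have alg (w d d' q q' r r' : R) : d = delta ^+ 2 * d' -> q = delta ^+ 2 * q' ->
  r = delta ^+ 6 * r' ->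
  w ^+ 14 * ((d * d) * q + 1 / 512 * ((w * w) * r)) =
  delta ^+ 6 * (w ^+ 14 * ((d' * d') * q' + 1 / 512 * ((w * w) * r'))).
  by move=> -> -> ->; ring.
exact: (alg _ _ _ _ _ _ _ (frame_det_change Ox) (frame_quad_change sf Ox)
  (frame_quad_det_change Ox)).
Qed.

Lemma frame_pde_change :
  (forall y, Omega y ->
    4 * (frame_det i0 i1 f y * frame_lap i0 i1 f (frame_det i0 i1 f) y) =
    7 * frame_quad i0 i1 f (frame_det i0 i1 f) y) ->
  forall y, Omega y ->
    4 * (frame_det e1 e2 f y * frame_lap e1 e2 f (frame_det e1 e2 f) y) =
    7 * frame_quad e1 e2 f (frame_det e1 e2 f) y.
Proof.
move=> pde y Oy; have sDe := smooth_frame_det openO e1 e2 sf.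
have sDi := smooth_frame_det openO i0 i1 sf.
have alg (d d' l l1 l' q q' : R) : 4 * (d' * l') = 7 * q' ->
  d = delta ^+ 2 * d' -> l = delta ^+ 2 * l1 -> l1 = delta ^+ 2 * l' ->
  q = delta ^+ 6 * q' -> 4 * (d * l) = 7 * q.
  move=> E -> -> -> ->; transitivity (delta ^+ 6 * (4 * (d' * l'))); first ring.
  by rewrite E; ring.
exact: (alg _ _ _ _ _ _ _ (pde y Oy) (frame_det_change Oy)
  (frame_lap_change sDe Oy) (frame_lap_scale sDi frame_det_change Oy)
  (frame_quad_det_change Oy)).
Qed.

End FrameChange.

Section NormalFrame.
Context {R : realType}.

(** The second vector is orthogonal to the covector [p], [q], normalized, and the
    first is obtained from it by a rotation through a right angle for the inner
    product defined by [A], [B], [E]. *)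
Lemma normal_frame (A B E p q : R) : 0 < A -> 0 < A * E - B ^+ 2 ->
  exists a1 a2 c1 c2 : R,
  [/\ A * a1 ^+ 2 + 2 * B * a1 * a2 + E * a2 ^+ 2 = 1,
      A * c1 ^+ 2 + 2 * B * c1 * c2 + E * c2 ^+ 2 = 1,
      A * a1 * c1 + B * (a1 * c2 + a2 * c1) + E * a2 * c2 = 0 &
      p * c1 + q * c2 = 0].
Proof.
move=> A0 H0.
have pos (u v : R) : (u != 0) || (v != 0) ->
    0 < A * u ^+ 2 + 2 * B * u * v + E * v ^+ 2.
  move=> uv; rewrite -(pmulr_rgt0 _ A0).
  have -> : A * (A * u ^+ 2 + 2 * B * u * v + E * v ^+ 2) =
            (A * u + B * v) ^+ 2 + (A * E - B ^+ 2) * v ^+ 2 by ring.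
  have [v0|v0] := eqVneq v 0.
    rewrite v0 eqxx orbF in uv; rewrite v0 !mulr0 addr0 expr0n mulr0 addr0.
    by rewrite exprn_even_gt0//= mulf_neq0// gt_eqF.
  by rewrite ltr_wpDl ?sqr_ge0// mulr_gt0// exprn_even_gt0.
have [u [v [uv E0]]] : exists u v : R, (u != 0) || (v != 0) /\ p * u + q * v = 0.
  have [p0|p0] := eqVneq p 0.
    by exists 1, (- 0 : R); rewrite oner_neq0 p0; split=> //; ring.
  by exists (- q), p; rewrite p0 orbT; split=> //; ring.
set n := A * u ^+ 2 + 2 * B * u * v + E * v ^+ 2.
have n0 : 0 < n by exact: pos.
pose k := Num.sqrt n; have k2 : k ^+ 2 = n by rewrite sqr_sqrtr// ltW.
have k0 : k != 0 by rewrite gt_eqF// sqrtr_gt0.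
pose d := Num.sqrt (A * E - B ^+ 2).
have d2 : d ^+ 2 = A * E - B ^+ 2 by rewrite sqr_sqrtr// ltW.
have d0 : d != 0 by rewrite gt_eqF// sqrtr_gt0.
exists ((B * u + E * v) / (k * d)), (- (A * u + B * v) / (k * d)), (u / k), (v / k).
have n0' : n != 0 by rewrite gt_eqF.
have H0' : A * E - B ^+ 2 != 0 by rewrite gt_eqF.
split.
- transitivity ((A * E - B ^+ 2) * n / (k ^+ 2 * d ^+ 2)).
    by rewrite /n; field; rewrite k0 d0.
  by rewrite k2 d2; field; rewrite n0' H0'.
- transitivity (n / k ^+ 2); first by rewrite /n; field.
  by rewrite k2 divff.
- by field; rewrite k0 d0.
- by rewrite 2!mulrA -mulrDl E0 mul0r.
Qed.

End NormalFrame.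

(** * The Calabi metric in terms of the Hessian determinant *)

Section TwoByTwo.
Context {R : realType}.
Implicit Types (A : 'M[R]_2).

Lemma det2 A : \det A = A 0 0 * A 1 1 - A 0 1 * A 1 0.
Proof.
rewrite (expand_det_row _ 0) sum_I2 /cofactor !det_mx11 !mxE /=.
have -> : lift 0 0 = 1 :> 'I_2 by apply/val_inj.
have -> : lift 1 0 = 0 :> 'I_2 by apply/val_inj.
by rewrite expr0 expr1 mul1r mulN1r mulrN.
Qed.

Lemma invmx2 A : \det A != 0 ->
  [/\ invmx A 0 0 = A 1 1 / \det A, invmx A 0 1 = - A 0 1 / \det A,
      invmx A 1 0 = - A 1 0 / \det A & invmx A 1 1 = A 0 0 / \det A].
Proof.
move=> dA; pose N : 'M[R]_2 := \matrix_(i, j)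
  ((if i == 0 then if j == 0 then A 1 1 else - A 0 1
    else if j == 0 then - A 1 0 else A 0 0) / \det A).
have uA : A \in unitmx by rewrite unitmxE unitfE.
suff -> : invmx A = N by rewrite !mxE.
rewrite -[RHS](mulKmx uA) -[LHS]mulmx1; congr (_ *m _).
apply/matrixP => i j; rewrite !mxE sum_I2 !mxE /=.
have dE := det2 A.
have [->|->] := ordI2_cases i; have [->|->] := ordI2_cases j => /=.
- by rewrite -[LHS](divff dA) dE; field; rewrite -dE.
- by field.
- by field.
- by rewrite -[LHS](divff dA) dE; field; rewrite -dE.
Qed.

End TwoByTwo.

Section ChainRule.
Context {R : realType}.
Implicit Types (h : 'rV[R]_2 -> R) (x v : 'rV[R]_2).

Lemma is_derive_comp (phi : R -> R) (a : R) h x v :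
  is_derive (h x) 1 phi a -> differentiable h x ->
  is_derive x v (phi \o h) (a * 'D_v h x).
Proof.
move=> [dphi phia] dh.
have dp : differentiable phi (h x) by apply/derivable1_diffP.
have dc : differentiable (phi \o h) x by exact: differentiable_comp.
apply: DeriveDef; first exact: diff_derivable.
rewrite (deriveE v dc) (deriveE v dh) -phia (deriveE (1 : R^o) dp) diff_comp//=.
by rewrite -[X in 'd phi _ X]mulr1 [LHS]linearZ [LHS]mulrC.
Qed.

Lemma is_derive_powR (a : R) h x v : 0 < h x -> differentiable h x ->
  is_derive x v (fun y => h y `^ a) (a * h x `^ (a - 1) * 'D_v h x).
Proof. by move=> h0 dh; exact: (is_derive_comp v (is_derive1_powR a h0) dh). Qed.

End ChainRule.

Section CalabiMetric.
Context {R : realType}.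
Implicit Types (g h : 'rV[R]_2 -> R) (x y v w : 'rV[R]_2).
Variable Omega : set 'rV[R]_2.
Hypothesis openO : open Omega.
Local Notation smooth := (smooth_on Omega).
Local Notation i0 := (delta_mx 0 0 : 'rV[R]_2).
Local Notation i1 := (delta_mx 0 1 : 'rV[R]_2).
Variable f : 'rV[R]_2 -> R.
Hypothesis sf : smooth f.
Hypothesis posf : forall x, Omega x -> positive_definite (hessian f x).
Let D := frame_det i0 i1 f.
Let sD : smooth D := smooth_frame_det openO i0 i1 sf.

Lemma hessianE y : Omega y ->
  [/\ hessian f y 0 0 = 'D_i0 ('D_i0 f) y, hessian f y 0 1 = 'D_i1 ('D_i0 f) y,
      hessian f y 1 0 = 'D_i1 ('D_i0 f) y & hessian f y 1 1 = 'D_i1 ('D_i1 f) y].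
Proof.
move=> Oy; split; [exact: mxE|exact: mxE|rewrite mxE|exact: mxE].
exact: (schwarz openO i1 i0 sf Oy).
Qed.

Lemma det_hessian y : Omega y -> \det (hessian f y) = D y.
Proof.
move=> /hessianE[h00 h01 h10 h11]; rewrite det2 h00 h01 h10 h11.
by rewrite /D /frame_det mulN1r.
Qed.

(** Positive definiteness is tested on the vectors (1, 0) and (- f_12, f_11). *)
Lemma hessian_pos y : Omega y -> 0 < 'D_i0 ('D_i0 f) y /\ 0 < D y.
Proof.
move=> Oy; have := posf Oy; have [h00 h01 h10 h11] := hessianE Oy.
set a := 'D_i0 ('D_i0 f) y in h00 *; set b := 'D_i1 ('D_i0 f) y in h01 h10.
set c := 'D_i1 ('D_i1 f) y in h11.
have DE : D y = a * c - b ^+ 2 by rewrite /D /frame_det mulN1r expr2.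
move=> P; have {}P (s t : R) : (s != 0) || (t != 0) ->
    0 < s ^+ 2 * a + 2 * (s * t * b) + t ^+ 2 * c.
  move=> st; pose v : 'rV[R]_2 := \row_i (if i == 0 then s else t).
  have v0 : v 0 0 = s by rewrite mxE.
  have v1 : v 0 1 = t by rewrite mxE.
  have vn : v != 0.
    by apply: contraTneq st => E; rewrite -v0 -v1 E !mxE eqxx.
  have := P v vn; rewrite mxE sum_I2 !mxE !sum_I2 -!/(fun_of_matrix _ _ _).
  rewrite h00 h01 h10 h11 v0 v1.
  rewrite /= => Q; suff -> : s ^+ 2 * a + 2 * (s * t * b) + t ^+ 2 * c =
    (s * a + t * b) * s + (s * b + t * c) * t by [].
  by ring.
have a0 : 0 < a by have := P 1 0; rewrite oner_neq0 => /(_ isT); lra.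
split; first exact: a0.
have := P (- b) a; rewrite (gt_eqF a0) orbT DE => /(_ isT).
have -> : (- b) ^+ 2 * a + 2 * (- b * a * b) + a ^+ 2 * c = a * (a * c - b ^+ 2).
  by ring.
by rewrite pmulr_rgt0.
Qed.

Lemma grad_normsqE h y : Omega y ->
  grad_normsq (hessian f) h y = frame_quad i0 i1 f h y / D y.
Proof.
move=> Oy; have [h00 h01 h10 h11] := hessianE Oy.
have [_ d0] := hessian_pos Oy; have dE := det_hessian Oy.
have dn : \det (hessian f y) != 0 by rewrite dE gt_eqF.
have [n00 n01 n10 n11] := invmx2 dn.
rewrite /grad_normsq sum_I2 !sum_I2 n00 n01 n10 n11 dE h00 h01 h10 h11.
have alg (a b c d k l : R) : c / d * k * k + - b / d * k * l
    + (- b / d * l * k + a / d * l * l) =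
    (c * (k * k) + (- 2) * (b * (k * l)) + a * (l * l)) / d by ring.
exact: alg.
Qed.

Lemma det_differentiable y : Omega y -> differentiable D y.
Proof. exact: (smooth_differentiable openO sD). Qed.

Lemma partial_rho i y : Omega y ->
  partial i (rho f) y = - (1 / 4) * D y `^ (- (1 / 4) - 1) * partial i D y.
Proof.
move=> Oy; have [_ d0] := hessian_pos Oy.
have E z : Omega z -> rho f z = D z `^ (- (1 / 4)).
  by move=> Oz; rewrite /rho (det_hessian Oz).
apply: (etrans (eq_on_derive openO (delta_mx 0 i) E Oy)).
have [_ E1] := is_derive_powR (- (1 / 4)) (delta_mx 0 i) d0
  (det_differentiable Oy).
exact: E1.
Qed.

Let V0 y := 'D_i1 ('D_i1 f) y * 'D_i0 D y + (-1) * ('D_i1 ('D_i0 f) y * 'D_i1 D y).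
Let V1 y := 'D_i0 ('D_i0 f) y * 'D_i1 D y + (-1) * ('D_i1 ('D_i0 f) y * 'D_i0 D y).

(** The vector field whose divergence defines the Laplacian of rho is, up to the
    factor - D^(-7/4) / 4, the cofactor matrix of the Hessian applied to the
    gradient of D. *)
Lemma laplace_flux y : Omega y ->
  Num.sqrt (\det (hessian f y)) *
    (\sum_j invmx (hessian f y) 0 j * partial j (rho f) y) =
    - (1 / 4) * (D y `^ (- (7 / 4)) * V0 y) /\
  Num.sqrt (\det (hessian f y)) *
    (\sum_j invmx (hessian f y) 1 j * partial j (rho f) y) =
    - (1 / 4) * (D y `^ (- (7 / 4)) * V1 y).
Proof.
move=> Oy; have [h00 h01 h10 h11] := hessianE Oy.
have [_ d0] := hessian_pos Oy; have dE := det_hessian Oy.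
have dn : \det (hessian f y) != 0 by rewrite dE gt_eqF.
have [n00 n01 n10 n11] := invmx2 dn.
rewrite !sum_I2 n00 n01 n10 n11 dE h00 h01 h10 h11.
rewrite (partial_rho 0 Oy) (partial_rho 1 Oy).
have E : Num.sqrt (D y) * ((D y)^-1 * D y `^ (- (1 / 4) - 1)) = D y `^ (- (7 / 4)).
  rewrite -(powR12_sqrt (ltW d0)) -(powR_inv1 (ltW d0)).
  rewrite -!powRD ?(gt_eqF d0) ?implybT//; congr (_ `^ _).
  by field.
have alg (a b c k l q s d p : R) : s * (d^-1 * q) = p ->
   s * (c / d * (- (1 / 4) * q * k) + - b / d * (- (1 / 4) * q * l)) =
   - (1 / 4) * (p * (c * k + (-1) * (b * l))) /\
   s * (- b / d * (- (1 / 4) * q * k) + a / d * (- (1 / 4) * q * l)) =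
   - (1 / 4) * (p * (a * l + (-1) * (b * k))).
  by move=> <-; split; ring.
exact: alg E.
Qed.

Lemma derive_flux v V y : smooth V -> Omega y ->
  'D_v (fun z => - (1 / 4) * (D z `^ (- (7 / 4)) * V z)) y =
  - (1 / 4) * (D y `^ (- (7 / 4) - 1) *
               (- (7 / 4) * 'D_v D y * V y + D y * 'D_v V y)).
Proof.
move=> sV Oy; have [_ d0] := hessian_pos Oy.
have dP := is_derive_powR (- (7 / 4)) v d0 (det_differentiable Oy).
have dV := derivableP (smooth_derivable openO v sV Oy).
have dM := is_deriveM dP dV.
have dC := is_deriveM (is_derive_cst (- (1 / 4) : R) y v) dM.
apply: (etrans (derive_val (is_derive := dC))).
rewrite scaler0 addr0.
have -> : D y `^ (- (7 / 4)) = D y `^ (- (7 / 4) - 1) * D y.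
  rewrite -[X in _ = _ * X](powRr1 (ltW d0)) -powRD ?(gt_eqF d0) ?implybT//.
  by rewrite subrK.
have alg (c a b e dd l V' : R) :
    c * (a * e * l + V' * (b * a * dd)) = c * (a * (b * dd * V' + e * l)) by ring.
exact: alg.
Qed.

Lemma smooth_V0 : smooth V0.
Proof.
exact: (smooth_add openO
  (smooth_mul openO (smooth_derive openO i1 (smooth_derive openO i1 sf))
                    (smooth_derive openO i0 sD))
  (smooth_mul openO (smooth_cst (-1))
    (smooth_mul openO (smooth_derive openO i1 (smooth_derive openO i0 sf))
                      (smooth_derive openO i1 sD)))).
Qed.

Lemma smooth_V1 : smooth V1.
Proof.
exact: (smooth_add openO
  (smooth_mul openO (smooth_derive openO i0 (smooth_derive openO i0 sf))
                    (smooth_derive openO i1 sD))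
  (smooth_mul openO (smooth_cst (-1))
    (smooth_mul openO (smooth_derive openO i1 (smooth_derive openO i0 sf))
                      (smooth_derive openO i0 sD)))).
Qed.

Lemma derive_binomial v a b k l y : smooth a -> smooth b -> smooth k -> smooth l ->
  Omega y -> 'D_v (fun z => a z * k z + (-1) * (b z * l z)) y =
  'D_v a y * k y + a y * 'D_v k y - ('D_v b y * l y + b y * 'D_v l y).
Proof.
move=> sa sb sk sl Oy; have sbl := smooth_mul openO sb sl.
apply: (etrans (derive_add openO v (smooth_mul openO sa sk)
  (smooth_mul openO (smooth_cst (-1)) sbl) Oy)).
congr (_ + _); first exact: (derive_mul openO v sa sk Oy).
apply: (etrans (derive_cmul openO v (-1) sbl Oy)).
by rewrite mulN1r; congr (- _); exact: (derive_mul openO v sb sl Oy).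
Qed.

(** The cofactor matrix of a Hessian is divergence free: the third derivatives of
    [f] cancel. *)
Lemma divergence_V y : Omega y ->
  'D_i0 V0 y + 'D_i1 V1 y = frame_lap i0 i1 f D y.
Proof.
move=> Oy.
have s00 := smooth_derive openO i0 (smooth_derive openO i0 sf).
have s01 := smooth_derive openO i1 (smooth_derive openO i0 sf).
have s11 := smooth_derive openO i1 (smooth_derive openO i1 sf).
have sD0 := smooth_derive openO i0 sD; have sD1 := smooth_derive openO i1 sD.
have alg (a b c k l m l' k0 k1 a1 b0 b1 c0 x z : R) : l' = l -> c0 = b1 -> b0 = a1 ->
  x = c0 * k0 + c * k - (b0 * k1 + b * l') ->
  z = a1 * k1 + a * m - (b1 * k0 + b * l) ->
  x + z = c * k + (- 2) * (b * l) + a * m.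
  by move=> -> -> -> -> ->; ring.
apply: (alg _ _ _ _ _ _ _ _ _ _ _ _ _ _ _ (swap12 openO i0 i1 sD Oy)
  (swap122 openO i0 i1 sf Oy) (swap12 openO i0 i1 (smooth_derive openO i0 sf) Oy)
  (derive_binomial i0 s11 s01 sD0 sD1 Oy)
  (derive_binomial i1 s00 s01 sD1 sD0 Oy)).
Qed.

(** Multiplied by a power of D, the Laplacian of rho is a multiple of
    4 D L(D) - 7 Q(D), where L denotes [frame_lap]. *)
Lemma laplace_beltrami_pde y : Omega y ->
  laplace_beltrami (hessian f) (rho f) y = 0 ->
  4 * (D y * frame_lap i0 i1 f D y) = 7 * frame_quad i0 i1 f D y.
Proof.
move=> Oy; have [_ d0] := hessian_pos Oy.
rewrite /laplace_beltrami sum_I2.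
have F0 z (Oz : Omega z) := (laplace_flux Oz).1.
have F1 z (Oz : Omega z) := (laplace_flux Oz).2.
set t0 := partial 0 _ y; set t1 := partial 1 _ y.
have -> : t0 = _ := etrans (eq_on_derive openO i0 F0 Oy)
  (derive_flux i0 smooth_V0 Oy).
have -> : t1 = _ := etrans (eq_on_derive openO i1 F1 Oy)
  (derive_flux i1 smooth_V1 Oy).
move=> /eqP; rewrite mulf_eq0 invr_eq0 (det_hessian Oy) sqrtr_eq0 leNgt d0 /=.
move=> /eqP E.
have p0 : D y `^ (- (7 / 4) - 1) != 0 by rewrite gt_eqF// powR_gt0.
have alg (p d l q d0' d1' v0 v1 x0 x1 : R) : p != 0 ->
  - (1 / 4) * (p * (- (7 / 4) * d0' * v0 + d * x0)) +
  - (1 / 4) * (p * (- (7 / 4) * d1' * v1 + d * x1)) = 0 ->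
  x0 + x1 = l -> q = d0' * v0 + d1' * v1 -> 4 * (d * l) = 7 * q.
  move=> pn H <- ->; apply/eqP; rewrite -subr_eq0.
  have : p * (4 * (d * (x0 + x1)) - 7 * (d0' * v0 + d1' * v1)) = 0.
    by rewrite -[RHS](mulr0 (-16)) -H; field.
  by move=> /eqP; rewrite mulf_eq0 (negPf pn).
apply: (alg _ _ _ _ _ _ _ _ _ _ p0 E (divergence_V Oy)).
have alg2 (a b c k l : R) : c * (k * k) + (- 2) * (b * (k * l)) + a * (l * l) =
  k * (c * k + (-1) * (b * l)) + l * (a * l + (-1) * (b * k)) by ring.
exact: alg2.
Qed.

Lemma rho_pow12 y : Omega y -> 0 < rho f y /\ rho f y `^ 12 = (D y ^+ 3)^-1.
Proof.
move=> Oy; have [_ d0] := hessian_pos Oy.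
rewrite /rho (det_hessian Oy); split; first exact: powR_gt0.
rewrite -powRrM -(powR_invn 3 (ltW d0)); congr (_ `^ _).
by field.
Qed.

(** The derivatives of rho = D^(-1/4) are - D^(-5/4) / 4 times those of D. *)
Lemma Phi_rho12 y : Omega y ->
  Phi f y / rho f y `^ 12 = frame_quad i0 i1 f D y / 16.
Proof.
move=> Oy; have [_ d0] := hessian_pos Oy; have [r0 r12] := rho_pow12 Oy.
rewrite /Phi (grad_normsqE _ Oy) r12 invrK.
have E : (D y `^ (- (1 / 4) - 1)) ^+ 2 * (D y) ^+ 2 = rho f y ^+ 2.
  rewrite -exprMn; congr (_ ^+ 2).
  rewrite -[X in _ * X](powRr1 (ltW d0)) -powRD ?(gt_eqF d0) ?implybT//.
  by rewrite subrK /rho (det_hessian Oy).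
have alg (q q' d c p r a b e k l k' l' : R) : d != 0 -> r != 0 ->
  c ^+ 2 * d ^+ 2 = r ^+ 2 -> k' = - (1 / 4) * c * k -> l' = - (1 / 4) * c * l ->
  (a * (k' * k') + (- 2) * (b * (k' * l')) + e * (l' * l')) / d / r ^+ 2 * d ^+ 3 =
  (a * (k * k) + (- 2) * (b * (k * l)) + e * (l * l)) / 16.
  move=> dn rn H -> ->.
  transitivity (1 / 16 * (c ^+ 2 * d ^+ 2 / r ^+ 2)
     * (a * (k * k) + (- 2) * (b * (k * l)) + e * (l * l))).
    by field; rewrite dn rn.
  by rewrite H divff ?expf_neq0//; field.
exact: (alg 0 0 _ _ 0 _ _ _ _ _ _ _ _ (lt0r_neq0 d0) (lt0r_neq0 r0) E
  (partial_rho 0 Oy) (partial_rho 1 Oy)).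
Qed.

Lemma grad_rho12 y : Omega y ->
  grad_normsq (hessian f) f y / rho f y `^ 12 =
  D y * D y * frame_quad i0 i1 f f y.
Proof.
move=> Oy; have [_ d0] := hessian_pos Oy; have [r0 r12] := rho_pow12 Oy.
rewrite (grad_normsqE _ Oy) r12 invrK.
by field; rewrite gt_eqF.
Qed.

End CalabiMetric.

(** * The maximum of the test function *)

Section MaximumPoint.
Context {R : realType}.
Implicit Types (x y v w : 'rV[R]_2).
Variable Omega : set 'rV[R]_2.
Hypothesis openO : open Omega.
Local Notation smooth := (smooth_on Omega).
Local Notation i0 := (delta_mx 0 0 : 'rV[R]_2).
Local Notation i1 := (delta_mx 0 1 : 'rV[R]_2).
Variable f : 'rV[R]_2 -> R.
Hypothesis sf : smooth f.
Hypothesis posf : forall x, Omega x -> positive_definite (hessian f x).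
Let D := frame_det i0 i1 f.
Hypothesis pde : forall y, Omega y ->
  4 * (D y * frame_lap i0 i1 f D y) = 7 * frame_quad i0 i1 f D y.

(** Both sides are homogeneous of the same degree under a change of frame, so the
    inequality may be checked in a normal frame, where it is
    [critical_point_bound]. *)
Lemma maximum_point_bound (C : R) x : Omega x -> 0 < C - f x ->
  (\forall y \near x, frame_test C i0 i1 f y <= frame_test C i0 i1 f x) ->
  D x * D x * frame_quad i0 i1 f f x +
  1 / 512 * ((C - f x) * (C - f x) * frame_quad i0 i1 f D x) <=
  100 * (C - f x) * D x ^+ 3.
Proof.
move=> Ox w0 Hmax; have [a0 d0] := hessian_pos openO sf posf Ox.
have dE : D x = 'D_i0 ('D_i0 f) x * 'D_i1 ('D_i1 f) x - 'D_i1 ('D_i0 f) x ^+ 2.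
  by rewrite /D /frame_det mulN1r expr2.
have d0' : 0 < 'D_i0 ('D_i0 f) x * 'D_i1 ('D_i1 f) x - 'D_i1 ('D_i0 f) x ^+ 2.
  by rewrite -dE.
have [a1 [a2 [c1 [c2 [N1 N2 N3 N4]]]]] :=
  normal_frame ('D_i0 f x) ('D_i1 f x) a0 d0'.
pose e1 : 'rV[R]_2 := \row_i (if i == 0 then a1 else a2).
pose e2 : 'rV[R]_2 := \row_i (if i == 0 then c1 else c2).
have e10 : e1 0 0 = a1 by rewrite mxE. have e11 : e1 0 1 = a2 by rewrite mxE.
have e20 : e2 0 0 = c1 by rewrite mxE. have e21 : e2 0 1 = c2 by rewrite mxE.
have alg2 (A B E p q r s p' q' r' s' t z : R) :
    p' = p -> q' = q -> r' = r -> s' = s ->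
    z = p' * r' * A + (p' * s' + q' * r') * B + q' * s' * E ->
    A * p * r + B * (p * s + q * r) + E * q * s = t -> z = t.
  by move=> -> -> -> -> -> <-; ring.
have sq (A B E p q : R) : A * p ^+ 2 + 2 * B * p * q + E * q ^+ 2 = 1 ->
    A * p * p + B * (p * q + q * p) + E * q * q = 1.
  by move=> <-; ring.
have f11 : 'D_e1 ('D_e1 f) x = 1.
  exact: (alg2 _ _ _ _ _ _ _ _ _ _ _ _ _ e10 e11 e10 e11
    (derive2_partial openO e1 e1 sf Ox) (sq _ _ _ _ _ N1)).
have f22 : 'D_e2 ('D_e2 f) x = 1.
  exact: (alg2 _ _ _ _ _ _ _ _ _ _ _ _ _ e20 e21 e20 e21
    (derive2_partial openO e2 e2 sf Ox) (sq _ _ _ _ _ N2)).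
have f12 : 'D_e2 ('D_e1 f) x = 0.
  exact: (alg2 _ _ _ _ _ _ _ _ _ _ _ _ _ e10 e11 e20 e21
    (derive2_partial openO e1 e2 sf Ox) N3).
have f2 : 'D_e2 f x = 0.
  apply: (etrans (smooth_derive_partial openO e2 sf Ox)).
  apply: etrans N4; rewrite e20 e21; congr (_ + _); exact: mulrC.
have pde' := frame_pde_change openO e1 e2 sf pde.
have alg3 (a b c : R) : a = 1 -> b = 0 -> c = 1 -> a * c + (-1) * (b * b) = 1.
  by move=> -> -> ->; ring.
have alg4 (a b c k l : R) : a = 1 -> b = 0 -> c = 1 ->
    c * (k * k) + (- 2) * (b * (k * l)) + a * (l * l) = k ^+ 2 + l ^+ 2.
  by move=> -> -> ->; ring.
set d := frame_orient e1 e2.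
have dn : 0 < d ^+ 6.
  have DE : frame_det e1 e2 f x = 1.
    exact: alg3 f11 f12 f22.
  have := frame_det_change openO e1 e2 sf Ox; rewrite DE -/d => E.
  rewrite exprn_even_gt0//=; apply/eqP => d00.
  by move: E; rewrite d00 expr0n mul0r => /eqP; rewrite oner_eq0.
have Hmax' : \forall y \near x, frame_test C e1 e2 f y <= frame_test C e1 e2 f x.
  apply: filterS2 Hmax (near_open openO Ox) => y H Oy.
  rewrite (frame_test_change openO e1 e2 sf C Oy).
  by rewrite (frame_test_change openO e1 e2 sf C Ox) ler_pM2l.
have B := critical_point_bound openO sf pde' Ox f11 f12 f22 f2 w0 Hmax'.
have alg (dt dt' q q' r r' w k l m : R) : dt = 1 -> dt = d ^+ 2 * dt' ->
    q = d ^+ 2 * q' -> r = d ^+ 6 * r' -> q = k ^+ 2 -> r = l ^+ 2 + m ^+ 2 ->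
    k ^+ 2 + w ^+ 2 * (l ^+ 2 + m ^+ 2) / 512 <= 100 * w ->
    dt' * dt' * q' + 1 / 512 * (w * w * r') <= 100 * w * dt' ^+ 3.
  move=> dt1 Et Eq Er Ek El H; rewrite -(ler_pM2l dn).
  have -> : d ^+ 6 * (dt' * dt' * q' + 1 / 512 * (w * w * r')) =
    (d ^+ 2 * dt') ^+ 2 * (d ^+ 2 * q') + w ^+ 2 * (d ^+ 6 * r') / 512 by field.
  have -> : d ^+ 6 * (100 * w * dt' ^+ 3) = 100 * w * (d ^+ 2 * dt') ^+ 3 by ring.
  by rewrite -Et -Eq -Er dt1 !expr1n mulr1 mul1r Ek El.
apply: (alg _ _ _ _ _ _ _ _ _ _ _ (frame_det_change openO e1 e2 sf Ox)
  (frame_quad_change openO e1 e2 sf sf Ox) (frame_quad_det_change openO e1 e2 sf Ox)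
  _ _ B).
- exact: alg3 f11 f12 f22.
- by apply: (etrans (alg4 _ _ _ _ _ f11 f12 f22)); rewrite f2 expr0n addr0.
- exact: (alg4 _ _ _ _ _ f11 f12 f22).
Qed.

Lemma frame_quad_ge0 h x : Omega x -> 0 <= frame_quad i0 i1 f h x.
Proof.
move=> Ox; have [a0 d0] := hessian_pos openO sf posf Ox.
have alg (a b c k l : R) : 0 < a -> 0 < a * c + (-1) * (b * b) ->
   0 <= c * (k * k) + (- 2) * (b * (k * l)) + a * (l * l).
  move=> a_gt0 dt; rewrite -(pmulr_rge0 _ a_gt0).
  have -> : a * (c * (k * k) + (- 2) * (b * (k * l)) + a * (l * l)) =
    (a * l - b * k) ^+ 2 + (a * c + (-1) * (b * b)) * k ^+ 2 by ring.
  by rewrite addr_ge0 ?sqr_ge0// mulr_ge0 ?sqr_ge0// ltW.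
exact: alg a0 d0.
Qed.

End MaximumPoint.

Section Sublevel.
Context {R : realType}.
Implicit Types (x y : 'rV[R]_2).

(** At a point of the closure of the sublevel set the extension of [f] is at most
    [c] < [C], so that point is not on the frontier of [Omega]. *)
Lemma sublevel_compact (Omega : set 'rV[R]_2) (f : 'rV[R]_2 -> R) (C c : R) :
  open Omega -> Omega `<=` disc 1 -> boundary_value Omega f C -> c < C ->
  compact [set x | Omega x /\ f x <= c].
Proof.
move=> openO O1 [F [cF Ff FC]] cC; apply: bounded_closed_compact.
  exists 1; split=> // M M1 x [/O1/= xd _].
  have N i : `|x 0 i| <= 1.
    rewrite -(@ler_pXn2r _ 2)// ?nnegrE// expr1n real_normK ?num_real//.
    move: xd; rewrite /disc /mkset sum_I2 expr1n => xd.
    have s0 := sqr_ge0 (x 0 0); have s1 := sqr_ge0 (x 0 1).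
    by have [->|->] := ordI2_cases i; lra.
  by rewrite (le_trans (norm_le_coord (N 0) (N 1)))// ltW.
apply/closure_id/seteqP; split; first exact: subset_closure.
move=> x clx; pose K := [set x | Omega x /\ f x <= c].
have clO : closure Omega x.
  by move: clx; apply: closureS => y [].
have Fx : F x <= c.
  rewrite leNgt; apply/negP => cFx.
  have /subspace_continuousP/(_ x clO) := cF.
  move=> /cvgr_gt/(_ _ cFx) => /clx [y [[Oy fy]]] /(_ (subset_closure Oy)) cFy.
  have : c < F y := cFy.
  by rewrite (Ff _ Oy) ltNge fy.
have Ox : Omega x.
  apply: contrapT => nOx; move: Fx; rewrite FC ?leNgt ?cC//.
  by split=> //; rewrite (iffLR (interior_id _) openO).
by split=> //; rewrite -Ff.
Qed.

End Sublevel.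

Section MainBound.
Context {R : realType}.
Implicit Types (x y : 'rV[R]_2).
Local Notation i0 := (delta_mx 0 0 : 'rV[R]_2).
Local Notation i1 := (delta_mx 0 1 : 'rV[R]_2).

Definition test_bound (b C : R) : R := 100 * b ^+ 12 * C ^+ 15.

(** The maximum over the compact sublevel set is either zero, on the level
    [f = c], or is attained in its interior, where [maximum_point_bound] applies
    and [D ^+ 3] is the twelfth power of [1 / rho]. *)
Lemma frame_test_bound (Omega : set 'rV[R]_2) (f : 'rV[R]_2 -> R) (b c C : R) :
  0 < b -> c < C -> open Omega -> Omega `<=` disc 1 ->
  strictly_convex_smooth_on Omega f -> boundary_value Omega f C ->
  (forall x, Omega x -> 0 <= f x) ->
  (forall x, Omega x -> laplace_beltrami (hessian f) (rho f) x = 0) ->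
  (forall x, Omega x -> 1 / rho f x <= b) ->
  forall x, Omega x -> f x <= c -> frame_test c i0 i1 f x <= test_bound b c.
Proof.
move=> b0 cC openO O1 [sf posf] bv f0 lap rb x Ox fx.
pose D := frame_det i0 i1 f.
have pde y (Oy : Omega y) := laplace_beltrami_pde openO sf posf Oy (lap y Oy).
pose K := [set x | Omega x /\ f x <= c].
have cK : compact K := sublevel_compact openO O1 bv cC.
have S_cont : {within K, continuous (frame_test c i0 i1 f)}.
  apply: continuous_in_subspaceT => y /set_mem[Oy _].
  have [sS _] := frame_test_smooth_jet openO i0 i1 sf c i0 Oy.
  exact: (smooth_continuous sS Oy).
have K0 : K !=set0 by exists x.
have [z /set_mem[Oz fz] Hz] := compact_EVT_max K0 cK S_cont.
have c0 : 0 <= c := le_trans (f0 x Ox) fx.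
apply: (le_trans (Hz x _)); first exact/mem_set.
have Sz0 : 0 <= test_bound b c.
  by rewrite /test_bound mulr_ge0 ?exprn_ge0// mulr_ge0 ?exprn_ge0// ltW.
have [fzc|fzc] := eqVneq (f z) c.
  by rewrite /frame_test fzc subrr expr0n mul0r.
have w0 : 0 < c - f z by rewrite subr_gt0 lt_neqAle fzc.
have zmax : \forall y \near z, frame_test c i0 i1 f y <= frame_test c i0 i1 f z.
  have /cvgr_lt H := smooth_continuous sf Oz.
  have fzc' : f z < c by rewrite -subr_gt0.
  apply: filterS2 (near_open openO Oz) (H c fzc') => y Oy fy.
  by apply: Hz; apply/mem_set; split=> //; exact: ltW.
have B := maximum_point_bound openO sf posf pde Oz w0 zmax.
have wc : c - f z <= c by rewrite gerBl f0.
have [r0 r12] := rho_pow12 openO sf posf Oz.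
have [_ d0] := hessian_pos openO sf posf Oz.
have D3 : D z ^+ 3 <= b ^+ 12.
  have -> : D z ^+ 3 = (1 / rho f z) ^+ 12.
    rewrite div1r exprVn -(powR_mulrn 12 (ltW r0)) r12 invrK //.
  by rewrite ler_pXn2r ?nnegrE ?rb// ?divr_ge0// ltW.
rewrite /frame_test; apply: (le_trans (ler_wpM2l _ B)); 
  first exact: (exprn_ge0 _ (ltW w0)).
rewrite /test_bound.
have -> : (c - f z) ^+ 14 * (100 * (c - f z) * D z ^+ 3) =
   100 * (D z ^+ 3) * (c - f z) ^+ 15 by ring.
have D0 : 0 <= D z ^+ 3 by rewrite exprn_ge0// ltW.
apply: ler_pM.
- by rewrite mulr_ge0.
- by rewrite exprn_ge0// ltW.
- by rewrite ler_wpM2l.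
- by rewrite ler_pXn2r ?nnegrE// ltW.
Qed.

End MainBound.

Theorem proposition3p8 (R : realType) :
  exists d4 : R -> R -> R -> R,
  forall b C : R, 0 < b -> 0 < C ->
  exists alpha : R,
    [/\ 0 < alpha, 0 < d4 alpha b C &
    forall (Omega : set 'rV[R]_2) (f : 'rV[R]_2 -> R),
      normalized_convex_domain Omega ->
      strictly_convex_smooth_on Omega f ->
      ereal_inf [set (f x)%:E | x in Omega] = 0%E ->
      boundary_value Omega f C ->
      (forall x, Omega x -> laplace_beltrami (hessian f) (rho f) x = 0) ->
      (forall x, Omega x -> 1 / rho f x <= b) ->
      forall x, Omega x -> f x < C / 2 ->
        Phi f x / rho f x `^ alpha <= d4 alpha b C /\
        grad_normsq (hessian f) f x / rho f x `^ alpha <= d4 alpha b C].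
Proof.
(* The level 3C/4 leaves room above C/2, so that w >= C/4 there, and below C, so
   that the sublevel set is compact. *)
pose M (b C : R) := test_bound b (3 / 4 * C).
exists (fun _ b C => M b C / (C / 4) ^+ 14 + 32 * M b C / (C / 4) ^+ 16).
move=> b C b0 C0.
have M0 : 0 < M b C.
  by rewrite /M /test_bound !mulr_gt0 ?exprn_gt0// !mulr_gt0 ?invr_gt0.
have w0 : 0 < C / 4 by rewrite divr_gt0.
have p14 : 0 < M b C / (C / 4) ^+ 14 by rewrite divr_gt0 ?exprn_gt0.
have p16 : 0 < 32 * M b C / (C / 4) ^+ 16 by rewrite divr_gt0 ?mulr_gt0 ?exprn_gt0.
exists 12; split => [//||Omega f]; first by rewrite addr_gt0.
move=> [openO _ _ _ O1] fP inf0 bv lap rb x Ox fx.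
have f0 y : Omega y -> 0 <= f y.
  move=> Oy; have := @ereal_inf_lbound _ [set (f x)%:E | x in Omega]
    (f y)%:E.
  by rewrite inf0 lee_fin; apply; exists y.
have [sf posf] := fP.
have cC : 3 / 4 * C < C by lra.
have fx' : f x <= 3 / 4 * C by lra.
have S := frame_test_bound b0 cC openO O1 fP bv f0 lap rb Ox fx'.
rewrite -/(M b C) in S.
rewrite (Phi_rho12 openO sf posf Ox) (grad_rho12 openO sf posf Ox).
have qf := frame_quad_ge0 openO sf posf f Ox.
have qd := frame_quad_ge0 openO sf posf
  (frame_det (delta_mx 0 0) (delta_mx 0 1) f) Ox.
have alg (w d q q' m : R) : C / 4 <= w -> 0 <= q -> 0 <= q' ->
    w ^+ 14 * (d * d * q + 1 / 512 * (w * w * q')) <= m ->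
    q' / 16 <= 32 * m / (C / 4) ^+ 16 /\ d * d * q <= m / (C / 4) ^+ 14.
  move=> wC q0 q'0 H.
  have wn : 0 <= C / 4 by exact: ltW.
  have w' : 0 <= w by exact: le_trans wC.
  have W14 : (C / 4) ^+ 14 <= w ^+ 14 by rewrite ler_pXn2r ?nnegrE.
  have W16 : (C / 4) ^+ 16 <= w ^+ 16 by rewrite ler_pXn2r ?nnegrE.
  have dd0 : 0 <= d * d * q by rewrite mulr_ge0// -expr2 sqr_ge0.
  have A1 : (C / 4) ^+ 16 * q' <= w ^+ 16 * q' by rewrite ler_wpM2r.
  have A2 : (C / 4) ^+ 14 * (d * d * q) <= w ^+ 14 * (d * d * q).
    by rewrite ler_wpM2r.
  have A3 : w ^+ 14 * (d * d * q + 1 / 512 * (w * w * q')) =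
    w ^+ 14 * (d * d * q) + w ^+ 16 * q' / 512 by field.
  have A4 : 0 <= w ^+ 14 * (d * d * q) by rewrite mulr_ge0 ?exprn_ge0.
  have A5 : 0 <= w ^+ 16 * q' by rewrite mulr_ge0 ?exprn_ge0.
  rewrite A3 in H; rewrite !ler_pdivlMr ?exprn_gt0//.
  move: H A1 A2 A4 A5.
  move: (w ^+ 14 * (d * d * q)) (w ^+ 16 * q') (d * d * q) => s t p.
  by move: ((C / 4) ^+ 16) ((C / 4) ^+ 14) => k l *; split; lra.
have wC : C / 4 <= 3 / 4 * C - f x by lra.
have [P1 P2] := alg _ _ _ _ _ wC qf qd S.
split; [apply: (le_trans P1)|apply: (le_trans P2)]; lra.
Qed.
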